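(* Let $(M,c)$ be a space- and time-oriented connected conformal spin manifold of signature $(p,q)$, $n=p+q\ge3$. Let $\alpha\in Par(\Lambda^2_{\mathcal{T}}(M),\nabla^{nc})$, $\beta\in Par(\Lambda^{k+1}_{\mathcal{T}}(M),\nabla^{nc})$ with $0\le k\le n$, and $g\in c$. Then the nc-Killing form $([\beta,\alpha]_{\mathcal{T}})_+=proj^g_{\Lambda,+}([\beta,\alpha]_{\mathcal{T}})$ satisfies $$\tfrac12([\beta,\alpha]_{\mathcal{T}})_+=L_{V_\alpha}\beta_+-(k+1)\lambda_\alpha\cdot\beta_+\ \in\ \Omega^k_{nc,g}(M).$$ Here $L$ denotes the Lie derivative, $\beta_+=proj^g_{\Lambda,+}\beta$, $V_\alpha=(proj^g_{\Lambda,+}\alpha)^\sharp$ is the conformal vector field canonically associated to $\alpha$, and $\lambda_\alpha\in C^\infty(M)$ is defined by $L_{V_\alpha}g=2\lambda_\alpha g$. In particular, the right-hand side is again a nc-Killing $k$-form.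
   Context: Tractors: $\mathcal{T}(M)$ is the standard tractor bundle of $(M,c)$ (associated to the normal conformal Cartan geometry of type $(SO^+(p+1,q+1),P)$, $P$ the stabilizer of an isotropic ray) with tractor metric of signature $(p+1,q+1)$ and normal conformal tractor connection $\nabla^{nc}$; $\Lambda^{r}_{\mathcal{T}}(M)$ is the bundle of $r$-forms on $\mathcal{T}(M)$; $Par$ denotes $\nabla^{nc}$-parallel sections. Metric description: $g\in c$ gives $\mathcal{T}(M)\cong\underline{\mathbb{R}}\oplus TM\oplus\underline{\mathbb{R}}$, $(a,Y,b)=as_-+Y+bs_+$, with metric $a_1b_2+a_2b_1+g(Y_1,Y_2)$ and $\nabla^{nc}_X(a,Y,b)=(X(a)+K^g(X,Y),\nabla^g_XY+aX-bK^g(X)^\sharp,X(b)-g(X,Y))$, where $K^g=\frac{1}{n-2}(\frac{scal^g}{2(n-1)}g-Ric^g)$. A tractor $(r+1)$-form decomposes uniquely as $\alpha=s_+^\flat\wedge\alpha_++\alpha_0+s_-^\flat\wedge s_+^\flat\wedge\alpha_\mp+s_-^\flat\wedge\alpha_-$ with $\alpha_\pm\in\Omega^r(M)$, $\alpha_0\in\Omega^{r+1}(M)$, $\alpha_\mp\in\Omega^{r-1}(M)$; $proj^g_{\Lambda,+}\alpha:=\alpha_+$ (extended linearly to forms of mixed degree). The forms $\alpha_+$ arising from $\nabla^{nc}$-parallel $\alpha$ are called normal conformal (nc-)Killing $r$-forms, with space $\Omega^r_{nc,g}(M)$. Bracket: for a vector $X$ and a form $\omega$ put $X\cdot\omega:=X^\flat\wedge\omega-X\lrcorner\omega$,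 and for a pseudo-orthonormal basis define inductively $(e^\flat_{i_1}\wedge\dots\wedge e^\flat_{i_j})\cdot\omega:=e_{i_1}\cdot((e^\flat_{i_2}\wedge\dots\wedge e^\flat_{i_j})\cdot\omega)$, extended bilinearly; this is the associative (Clifford) product on forms, and is applied fibrewise to tractor forms. $[\alpha,\beta]_{\mathcal{T}}:=\alpha\cdot\beta-\beta\cdot\alpha$. *)

(* Defs.v *)
(* A manifold is a topological space with a smooth atlas.  A section of a
   natural bundle is a family indexed by the charts: its value
   at a point x of the domain of chart i is written in the coordinate frame of
   chart i at x, and values on overlapping domains are related by the
   transition rule.  Values at points outside the domain of the chart are
   irrelevant: every condition below is guarded by chart_dom i x.  Vectors are rows. *)
From HB Require Import structures.
From mathcomp Require Import all_boot all_order all_algebra.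
From mathcomp Require Import all_classical all_reals all_analysis.

Set Implicit Arguments.
Unset Strict Implicit.
Unset Printing Implicit Defensive.

Import Order.TTheory GRing.Theory Num.Theory.
Import numFieldNormedType.Exports.

Local Open Scope classical_set_scope.
Local Open Scope ring_scope.

(* A form of mixed degree: its component of degree r is its restriction to the
   lists of length r. *)
Definition form (R : realType) (V : vectType R) : Type := seq V -> R^o.

Section Forms.
Context {R : realType} {V : vectType R}.
Implicit Types (w : form V) (xi : V -> R) (B : V -> V -> R) (s : seq V).

Definition alternating w : Prop :=
  (forall s1 s2 a u v,
     w (s1 ++ (a *: u + v) :: s2) = a * w (s1 ++ u :: s2) + w (s1 ++ v :: s2))
  /\ (forall s1 s2 s3 u, w (s1 ++ u :: s2 ++ u :: s3) = 0).

Definition is_form (r : nat) w : Prop :=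
  alternating w /\ forall s, size s <> r -> w s = 0.

Definition form_one : form V := fun s => if s is [::] then 1 else 0.

Definition covector xi : form V := fun s => if s is [:: v] then xi v else 0.

Definition wedge1 xi w : form V := fun s =>
  \sum_(i < size s) (-1) ^+ i * xi s`_i * w (take i s ++ drop i.+1 s).

Definition contract (v : V) w : form V := fun s => w (v :: s).

Definition clmul B (v : V) w : form V :=
  fun s => wedge1 (B v) w s - contract v w s.

Definition pseudo_orthonormal B (e : (\dim {:V}).-tuple V) : Prop :=
  [/\ basis_of fullv e,
      forall i j, i != j -> B (tnth e i) (tnth e j) = 0 &
      forall i, B (tnth e i) (tnth e i) = 1 \/ B (tnth e i) (tnth e i) = -1].

(* The coframe dual to e is B(e_i, e_i) e_i^flat, so the coefficient of
   e_(i_1)^flat /\ ... /\ e_(i_j)^flat, i_1 < ... < i_j, in a is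
   a(e_(i_1), ..., e_(i_j)) times the product of the signs B(e_i, e_i). *)
Definition clifford_in B (e : (\dim {:V}).-tuple V) (a b : form V) : form V :=
  fun s => \sum_(I : {set 'I_(\dim {:V})})
    let eI := [seq tnth e i | i <- enum I] in
    (\prod_(i in I) B (tnth e i) (tnth e i)) * a eI * foldr (clmul B) b eI s.

(* For forms a, b and a nondegenerate symmetric B this does not depend on the
   pseudo-orthonormal basis that xget selects. *)
Definition clifford B (a b : form V) : form V :=
  clifford_in B (xget (nseq_tuple _ 0) [set e | pseudo_orthonormal B e]) a b.

End Forms.

Section Smooth.
Context {R : realType} {n : nat} {W : normedModType R}.

Fixpoint iterated_derive (vs : seq 'rV[R]_n) (f : 'rV[R]_n -> W)
    : 'rV[R]_n -> W :=
  if vs is v :: vs' then fun y => 'D_v (iterated_derive vs' f) y else f.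

(* Meant for open U: f is C^oo on U when all its iterated directional
   derivatives exist and are continuous there. *)
Definition smooth_on (U : set 'rV[R]_n) (f : 'rV[R]_n -> W) : Prop :=
  forall vs y, U y ->
    {for y, continuous (iterated_derive vs f)} /\
    (forall v, derivable (iterated_derive vs f) y v).

End Smooth.

Record smooth_manifold (R : realType) (n : nat) (M : topologicalType) :=
  SmoothManifold {
    chart : Type;
    chart_dom : chart -> set M;
    chart_coord : chart -> M -> 'rV[R]_n;
    param : chart -> 'rV[R]_n -> M;
    manifold_hausdorff : hausdorff_space M;
    manifold_second_countable : @second_countable M;
    dom_cover : forall x, exists i, chart_dom i x;
    dom_open : forall i, open (chart_dom i);
    coord_open : forall i, open (chart_coord i @` chart_dom i);
    chart_coordK : forall i x, chart_dom i x -> param i (chart_coord i x) = x;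
    coord_continuous : forall i x, chart_dom i x -> {for x, continuous (chart_coord i)};
    param_continuous : forall i y, (chart_coord i @` chart_dom i) y ->
      {for y, continuous (param i)};
    transition_smooth : forall i j,
      smooth_on (chart_coord i @` (chart_dom i `&` chart_dom j)) (chart_coord j \o param i) }.

Section Manifold.
Context {R : realType} {n : nat} {M : topologicalType}.
Variable A : smooth_manifold R n M.
Local Notation T := 'rV[R]_n.

Definition dchart {W : normedModType R} (i : chart A) (v : T) (f : M -> W)
    (x : M) : W :=
  'D_v (f \o param i) (chart_coord i x).

Definition chart_smooth {W : normedModType R} (i : chart A) (U : set M)
    (f : M -> W) : Prop :=
  smooth_on (chart_coord i @` (U `&` chart_dom i)) (f \o param i).

Definition smooth_fun (f : M -> R^o) : Prop :=
  forall i, chart_smooth i setT f.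

(* differential at x of the change of coordinates from chart i to chart j *)
Definition dtrans (i j : chart A) (x : M) (v : T) : T :=
  dchart i v (chart_coord j) x.

Definition vector_field : Type := chart A -> M -> T.
Definition metric_field : Type := chart A -> M -> 'M[R]_n.
Definition form_field : Type := chart A -> M -> form T.

Definition eq_form_field (w w' : form_field) : Prop :=
  forall i x, chart_dom i x -> forall s, w i x s = w' i x s.

Definition lie_bracket (i : chart A) (X Y : M -> T) (x : M) : T :=
  dchart i (X x) Y x - dchart i (Y x) X x.

(* Lie derivatives are evaluated on coordinate vector fields, i.e. on fields
   constant in the chart. *)
Definition lie_form (V : vector_field) (w : form_field) : form_field :=
  fun i x s =>
    dchart i (V i x) (fun y => w i y s) x
    - \sum_(j < size s)
        w i x (set_nth 0 s j (lie_bracket i (V i) (fun=> s`_j) x)).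

Definition bil (G : 'M[R]_n) (u v : T) : R := (u *m G *m v^T) 0 0.

Definition lie_metric (V : vector_field) (g : metric_field)
    (i : chart A) (x : M) (u v : T) : R :=
  dchart i (V i x) (fun y => bil (g i y) u v : R^o) x
  - bil (g i x) (lie_bracket i (V i) (fun=> u) x) v
  - bil (g i x) u (lie_bracket i (V i) (fun=> v) x).

(* the vector v with bil G v = xi, for G symmetric and invertible *)
Definition sharp (G : 'M[R]_n) (xi : T -> R) : T :=
  (\row_j xi (delta_mx 0 j)) *m invmx G.

Definition sharp_field (g : metric_field) (w : form_field) : vector_field :=
  fun i x => sharp (g i x) (fun v => w i x [:: v]).

(* the Levi-Civita connection of g in chart i, from the Koszul formula on
   coordinate fields: christoffel g i x u v = nabla_u v for constant v *)
Definition christoffel (g : metric_field) (i : chart A) (x : M) (u v : T) : T :=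
  let dg (a b c : T) := dchart i a (fun y => bil (g i y) b c : R^o) x in
  sharp (g i x) (fun z => 2^-1 * (dg u v z + dg v u z - dg z u v)).

Definition nabla (g : metric_field) (i : chart A) (X : T) (Y : M -> T) (x : M)
    : T :=
  dchart i X Y x + christoffel g i x X (Y x).

(* R(X, Y) Z for coordinate fields X, Y, Z, which have [X, Y] = 0 *)
Definition curvature (g : metric_field) (i : chart A) (x : M) (X Y Z : T) : T :=
  nabla g i X (nabla g i Y (fun=> Z)) x - nabla g i Y (nabla g i X (fun=> Z)) x.

Definition ricci (g : metric_field) (i : chart A) (x : M) : 'M[R]_n :=
  \matrix_(b, c)
    \sum_a curvature g i x (delta_mx 0 a) (delta_mx 0 b) (delta_mx 0 c) 0 a.

Definition scal (g : metric_field) (i : chart A) (x : M) : R :=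
  \tr (invmx (g i x) *m ricci g i x).

Definition Kg (g : metric_field) (i : chart A) (x : M) : 'M[R]_n :=
  (n%:R - 2)^-1 *:
    ((scal g i x / (2 * (n%:R - 1))) *: g i x - ricci g i x).

(* In the metric g, the tractor (a, Y, b) is a s_- + Y + b s_+ . *)
Definition tractor : vectType R := (R^o * T * R^o)%type.

Definition s_minus : tractor := (1 : R^o, 0, 0).
Definition s_plus : tractor := (0 : R^o, 0, 1).

Definition tmetric (G : 'M[R]_n) (t1 t2 : tractor) : R :=
  t1.1.1 * t2.2 + t2.1.1 * t1.2 + bil G t1.1.2 t2.1.2.

Definition tractor_chart (i j : chart A) (x : M) (t : tractor) : tractor :=
  (t.1.1, dtrans i j x t.1.2, t.2).

(* The identification of the descriptions of the tractor bundle by g and by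
   e^(2 sigma) g: the projecting slot b has conformal weight 1, and the other
   two rules follow by compatibility with nabla^nc and with the tractor
   metric. *)
Definition tractor_conf (g : metric_field) (sigma : M -> R^o) (i : chart A)
    (x : M) (t : tractor) : tractor :=
  let dsigma (v : T) : R := dchart i v sigma x in
  let grad := sharp (g i x) dsigma in
  let: (a, Y, b) := t in
  (expR (- sigma x) * (a - dsigma Y - 2^-1 * b * dsigma grad) : R^o,
   expR (- sigma x) *: (Y + b *: grad),
   expR (sigma x) * b).

(* nabla^nc_X t in the metric g, for a section t written in chart i *)
Definition tractor_nabla (g : metric_field) (i : chart A) (X : T)
    (t : M -> tractor) (x : M) : tractor :=
  let a := fun y => (t y).1.1 in
  let Y := fun y => (t y).1.2 in
  let b := fun y => (t y).2 in
  (dchart i X a x + bil (Kg g i x) X (Y x),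
   nabla g i X Y x + a x *: X - b x *: sharp (g i x) (bil (Kg g i x) X),
   dchart i X b x - bil (g i x) X (Y x)).

(* The induced connection on tractor forms, evaluated on tractors with constant
   components. *)
Definition tractor_form_nabla (g : metric_field) (i : chart A) (X : T)
    (w : M -> form tractor) (x : M) : form tractor :=
  fun s =>
    dchart i X (fun y => w y s) x
    - \sum_(j < size s) w x (set_nth 0 s j (tractor_nabla g i X (fun=> s`_j) x)).

Definition tractor_form_field : Type :=
  metric_field -> chart A -> M -> form tractor.

Definition rescaled (g g' : metric_field) (sigma : M -> R^o) : Prop :=
  smooth_fun sigma /\
  forall i x, chart_dom i x -> g' i x = expR (2 * sigma x) *: g i x.

(* Sections of the bundle of tractor r-forms of the conformal class c; the
   tractor bundle is glued from its descriptions by the charts and by the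
   metrics of c. *)
Definition tractor_form_section (c : set metric_field) (r : nat)
    (w : tractor_form_field) : Prop :=
  [/\ forall g i x, c g -> chart_dom i x -> is_form r (w g i x),
      forall g i s, c g -> chart_smooth i setT (fun y => w g i y s),
      forall g i j x s, c g -> chart_dom i x -> chart_dom j x ->
        w g i x s = w g j x (map (tractor_chart i j x) s) &
      forall g g' sigma i x s, c g -> c g' -> rescaled g g' sigma ->
        chart_dom i x -> w g i x s = w g' i x (map (tractor_conf g sigma i x) s)].

Definition Par (c : set metric_field) (r : nat) : set tractor_form_field :=
  [set w | tractor_form_section c r w /\
     forall g i x, c g -> chart_dom i x -> forall X s,
       tractor_form_nabla g i X (w g i) x s = 0].

(* A form on M as a tractor form, via the projection of tractors onto TM. *)
Definition tractor_lift (w : form T) : form tractor :=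
  fun s => w [seq t.1.2 | t : tractor <- s].

(* alpha = s_+^flat /\ a_+ + a_0 + s_-^flat /\ s_+^flat /\ a_-+
           + s_-^flat /\ a_- *)
Definition tractor_decomposition (G : 'M[R]_n) (alpha : form tractor)
    (ap a0 amp am : form T) : Prop :=
  forall s, alpha s =
    wedge1 (tmetric G s_plus) (tractor_lift ap) s
    + tractor_lift a0 s
    + wedge1 (tmetric G s_minus)
        (wedge1 (tmetric G s_plus) (tractor_lift amp)) s
    + wedge1 (tmetric G s_minus) (tractor_lift am) s.

Definition tangent_tractor (v : T) : tractor := (0 : R^o, v, 0).

(* The component a_+ of the decomposition, see plus_part_decomposition and
   plus_part_unique. *)
Definition plus_part (alpha : form tractor) : form T :=
  fun s => alpha (s_minus :: map tangent_tractor s).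

Definition proj_plus (g : metric_field) (w : tractor_form_field) : form_field :=
  fun i x => plus_part (w g i x).

Definition nc_killing (c : set metric_field) (r : nat) (g : metric_field)
    : set form_field :=
  [set w | exists2 alpha, Par c r.+1 alpha
                        & eq_form_field w (proj_plus g alpha)].

Definition tractor_bracket (w w' : tractor_form_field) : tractor_form_field :=
  fun g i x s =>
    clifford (tmetric (g i x)) (w g i x) (w' g i x) s
    - clifford (tmetric (g i x)) (w' g i x) (w g i x) s.

Definition conformal_factor (g : metric_field) (V : vector_field)
    (lambda : M -> R^o) : Prop :=
  smooth_fun lambda /\
  forall i x, chart_dom i x -> forall u v,
    lie_metric V g i x u v = 2 * lambda x * bil (g i x) u v.

End Manifold.

(* p is the number of negative (timelike) directions. *)
Definition eps_mx (R : realType) (p q : nat) : 'M[R]_(p + q) :=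
  block_mx (- 1%:M) 0 0 1%:M.

Section Signature.
Context {R : realType} {p q : nat} {M : topologicalType}.
Variable A : smooth_manifold R (p + q) M.
Local Notation n := (p + q)%N.
Local Notation T := 'rV[R]_n.
Local Notation eps := (eps_mx R p q).

Definition pseudo_metric (g : metric_field A) : Prop :=
  [/\ forall i x, chart_dom i x -> (g i x)^T = g i x,
      forall i x, chart_dom i x -> exists E : 'M[R]_n, E *m g i x *m E^T = eps,
      forall i, chart_smooth i setT (g i) &
      forall i j x, chart_dom i x -> chart_dom j x -> forall u v,
        bil (g i x) u v = bil (g j x) (dtrans i j x u) (dtrans i j x v)].

Definition conformal_class (c : set (metric_field A)) : Prop :=
  exists2 g0, pseudo_metric g0 &
    forall g, c g <-> pseudo_metric g /\ exists sigma, rescaled g0 g sigma.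

Definition SOplus (h : 'M[R]_n) : Prop :=
  [/\ h *m eps *m h^T = eps, 0 < \det (ulsubmx h) & 0 < \det (drsubmx h)].

(* Products, in the Clifford algebra of R^(p,q), of unit vectors among which
   an even number is timelike and an even number is spacelike. *)
Definition Spinplus (a : form T) : Prop :=
  exists s : seq T,
    [/\ all (fun v => (bil eps v v == 1) || (bil eps v v == -1)) s,
        ~~ odd (count (fun v => bil eps v v == 1) s),
        ~~ odd (count (fun v => bil eps v v == -1) s) &
        a = foldr (clmul (bil eps)) form_one s].

(* a . v = (h v) . a for all v: the image of a in SO^+(p,q) is h.  The matrix h
   acts on columns, hence the transpose. *)
Definition spin_covers (a : form T) (h : 'M[R]_n) : Prop :=
  forall v : T, clifford (bil eps) a (covector (bil eps v)) =
                clmul (bil eps) (v *m h^T) a.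

(* The local frame E a i consists of the rows of a matrix; the frames are
   related by E b = E a . h_ab. *)
Definition frame_transition (I : Type) (E : I -> metric_field A) (a b : I)
    (i : chart A) (x : M) : 'M[R]_n :=
  (E b i x *m invmx (E a i x))^T.

(* A reduction of the orthonormal frame bundle of g to SO^+(p,q), given by local
   sections: a space- and time-orientation. *)
Definition space_time_orientation (g : metric_field A) (I : Type)
    (U : I -> set M) (E : I -> metric_field A) : Prop :=
  (forall a, open (U a)) /\ (forall x, exists a, U a x) /\
  [/\ forall a i x, U a x -> chart_dom i x -> E a i x *m g i x *m (E a i x)^T = eps,
      forall a i, chart_smooth i (U a) (E a i),
      forall a i j x k, U a x -> chart_dom i x -> chart_dom j x ->
        row k (E a j x) = dtrans i j x (row k (E a i x)) &
      forall a b i x, U a x -> U b x -> chart_dom i x ->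
        SOplus (frame_transition E a b i x)].

(* A lift of the transition cocycle to Spin^+(p,q). *)
Definition spin_structure (I : Type) (U : I -> set M) (E : I -> metric_field A)
    (h : I -> I -> M -> form T) : Prop :=
  [/\ forall a b x, U a x -> U b x -> Spinplus (h a b x),
      forall a b x s, U a x -> U b x ->
        {for x, continuous (fun y => h a b y s)},
      forall a b i x, U a x -> U b x -> chart_dom i x ->
        spin_covers (h a b x) (frame_transition E a b i x) &
      forall a b d x, U a x -> U b x -> U d x ->
        clifford (bil eps) (h a b x) (h b d x) = h a d x].

Definition oriented_spin (c : set (metric_field A)) : Prop :=
  exists (g : metric_field A) (I : Type) (U : I -> set M)
         (E : I -> metric_field A) (h : I -> I -> M -> form T),
    [/\ c g, space_time_orientation g U E & spin_structure U E h].

End Signature.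

Section Projection.
Context {R : realType}.

Lemma wedge1_cons (V : vectType R) (xi : V -> R) (w : form V) v s :
  wedge1 xi w (v :: s) = xi v * w s - wedge1 xi (contract v w) s.
Proof.
rewrite /wedge1 /= big_ord_recl /= expr0 mul1r drop0; congr (_ + _).
rewrite -sumrN; apply: eq_bigr => i _.
by rewrite /contract /= exprS !mulN1r !mulNr.
Qed.

Lemma interiorC (V : vectType R) (w : form V) u v s : alternating w ->
  w (u :: v :: s) = - w (v :: u :: s).
Proof.
case=> lin alt.
have D s1 s2 a b : w (s1 ++ (a + b) :: s2) = w (s1 ++ a :: s2) + w (s1 ++ b :: s2).
  by have := lin s1 s2 1 a b; rewrite scale1r mul1r.
have h : w ((u + v) :: (u + v) :: s) = 0 := alt [::] [::] s (u + v).
have hu : w (u :: u :: s) = 0 := alt [::] [::] s u.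
have hv : w (v :: v :: s) = 0 := alt [::] [::] s v.
move: h; rewrite (D [::] ((u + v) :: s)) /= (D [:: u] s) (D [:: v] s) /= hu hv.
by rewrite add0r addr0 => /eqP; rewrite addr_eq0 => /eqP.
Qed.

Lemma alternating_interior (V : vectType R) (w : form V) v :
  alternating w -> alternating (contract v w).
Proof.
case=> lin alt; split=> [s1 s2 a u u'|s1 s2 s3 u].
  exact: (lin (v :: s1) s2 a u u').
exact: (alt (v :: s1) s2 s3 u).
Qed.

Lemma wedge1_0 (V : vectType R) (xi : V -> R) (w : form V) s :
  (forall s', w s' = 0) -> wedge1 xi w s = 0.
Proof. by move=> h; rewrite /wedge1 big1 // => i _; rewrite h mulr0. Qed.

Lemma wedge1_ext (V : vectType R) (xi : V -> R) (w w' : form V) s :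
  (forall s', w s' = w' s') -> wedge1 xi w s = wedge1 xi w' s.
Proof. by move=> h; apply: eq_bigr => i _; rewrite h. Qed.

Lemma wedge1_N (V : vectType R) (xi : V -> R) (w : form V) s :
  wedge1 xi (fun s' => - w s') s = - wedge1 xi w s.
Proof. by rewrite /wedge1 -sumrN; apply: eq_bigr => i _; rewrite mulrN. Qed.

Lemma split_form (V : vectType R) (xi : V -> R) (v : V) (s : seq V)
    (w : form V) : alternating w ->
  w s = wedge1 xi (contract v w) s + w [seq u - xi u *: v | u <- s].
Proof.
elim: s w => [|u s IH] w aw; first by rewrite /wedge1 big_ord0 add0r.
have [lin alt] := aw.
have /= := lin [::] [seq u - xi u *: v | u <- s] (- xi u) v u.
rewrite scaleNr [- (_ *: _) + _]addrC => ->; rewrite wedge1_cons.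
have := IH _ (alternating_interior u aw).
have := IH _ (alternating_interior v aw).
rewrite [wedge1 xi (contract v (contract v w)) s]wedge1_0; last first.
  by move=> s'; exact: (alt [::] [::]).
rewrite add0r /contract => <- ->.
have -> : wedge1 xi (fun s' => w (v :: u :: s')) s
        = - wedge1 xi (fun s' => w (u :: v :: s')) s.
  by rewrite -wedge1_N; apply: wedge1_ext => s'; rewrite interiorC.
by rewrite opprK mulNr addrACA subrr add0r.
Qed.

Lemma alternating_map (V V' : vectType R) (f : V' -> V) (w : form V) :
  (forall a u v, f (a *: u + v) = a *: f u + f v) ->
  alternating w -> alternating (fun s => w (map f s)).
Proof.
move=> fl [lin alt]; split=> [s1 s2 a u v|s1 s2 s3 u].
  by rewrite !map_cat /= fl lin.
by rewrite map_cat /= map_cat /=.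
Qed.

Variables (n : nat) (G : 'M[R]_n).
Local Notation TV := (@tractor R n).

Lemma tmetric_plus t : tmetric G s_plus t = t.1.1.
Proof. by rewrite /tmetric /= mul0r mulr1 /bil !mul0mx mxE addr0 add0r. Qed.

Lemma tmetric_minus t : tmetric G s_minus t = t.2.
Proof. by rewrite /tmetric /= mul1r mulr0 /bil !mul0mx mxE !addr0. Qed.

Let pi (t : TV) : TV := t - tmetric G s_plus t *: s_minus.
Let pi' (t : TV) : TV := t - tmetric G s_minus t *: s_plus.

Let pi_linear a u v : pi' (a *: u + v) = a *: pi' u + pi' v.
Proof.
rewrite /pi' !tmetric_minus /= scalerDl scalerBr opprD addrACA; congr (_ + _).
by congr (_ - _); rewrite scalerA.
Qed.

Let pipi t : pi (pi' t) = tangent_tractor t.1.2.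
Proof.
case: t => [[a Y] b]; rewrite /pi /pi' tmetric_plus tmetric_minus /=.
by congr (_, _, _); rewrite /= ?scaler0 ?subr0 // [X in _ - X]mulr1 subrr.
Qed.

Let pipi' t : pi' (pi t) = tangent_tractor t.1.2.
Proof.
case: t => [[a Y] b]; rewrite /pi /pi' tmetric_plus tmetric_minus /=.
by congr (_, _, _); rewrite /= ?scaler0 ?subr0 // [X in _ - X]mulr1 subrr.
Qed.

Lemma plus_part_decomposition (alpha : form TV) : alternating alpha ->
  tractor_decomposition G alpha (plus_part alpha)
    (fun s => alpha (map (@tangent_tractor R n) s))
    (fun s => alpha (s_plus :: s_minus :: map (@tangent_tractor R n) s))
    (fun s => alpha (s_plus :: map (@tangent_tractor R n) s)).
Proof.
move=> alt s.
have liftE (w : form TV) u :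
    tractor_lift (fun s => w (map (@tangent_tractor R n) s)) u
    = w [seq tangent_tractor t.1.2 | t : TV <- u].
  by rewrite /tractor_lift -map_comp.
have altp : alternating (fun s => alpha (map pi' s)) by exact: alternating_map.
rewrite (split_form (tmetric G s_minus) s_plus s alt) -/pi'.
have -> : alpha [seq pi' u | u <- s]
    = wedge1 (tmetric G s_plus) (tractor_lift (plus_part alpha)) s
      + tractor_lift (fun s => alpha (map (@tangent_tractor R n) s)) s.
  rewrite (split_form (tmetric G s_plus) s_minus s altp) -/pi; congr (_ + _).
    apply: wedge1_ext => u; rewrite /contract /=.
    have -> : pi' s_minus = s_minus.
      by rewrite /pi' tmetric_minus scale0r subr0.
    have := split_form (tmetric G s_plus) s_minus [seq pi' t | t <- u]
      (alternating_interior s_minus alt).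
    rewrite wedge1_0 ?add0r; last by move=> s'; exact: (proj2 alt [::] [::]).
    rewrite /contract => ->; rewrite -map_comp.
    rewrite [RHS](liftE (fun s => alpha (s_minus :: s))).
    by congr (alpha (_ :: _)); apply: eq_map => t; exact: pipi.
  rewrite liftE -map_comp; congr (alpha _); apply: eq_map => t; exact: pipi'.
rewrite addrC -!addrA; congr (_ + (_ + _)).
rewrite /wedge1 -big_split; apply: eq_bigr => i _ /=.
rewrite -mulrDr; congr (_ * _); set u := take i s ++ drop i.+1 s.
rewrite (split_form (tmetric G s_plus) s_minus u (alternating_interior s_plus alt)) -/pi.
have altm := alternating_interior s_minus (alternating_interior s_plus alt).
congr (_ + _).
  apply: wedge1_ext => t.
  rewrite (split_form (tmetric G s_plus) s_minus t altm) -/pi.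
  rewrite wedge1_0 ?add0r; last by move=> s'; exact: (proj2 alt [:: s_plus] [::]).
  rewrite (split_form (tmetric G s_minus) s_plus _ altm) -/pi'.
  rewrite wedge1_0 ?add0r; last by move=> s'; exact: (proj2 alt [::] [:: s_minus]).
  rewrite -map_comp [RHS](liftE (fun s => alpha (s_plus :: s_minus :: s))).
  by congr (alpha (_ :: _ :: _)); apply: eq_map => y; exact: pipi'.
rewrite (split_form (tmetric G s_minus) s_plus _ (alternating_interior s_plus alt)) -/pi'.
rewrite wedge1_0 ?add0r; last by move=> s'; exact: (proj2 alt [::] [::]).
rewrite -map_comp [RHS](liftE (fun s => alpha (s_plus :: s))).
by congr (alpha (_ :: _)); apply: eq_map => y; exact: pipi'.
Qed.

Lemma plus_part_unique (alpha : form TV) (ap a0 amp am : form 'rV[R]_n) :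
  alternating a0 -> tractor_decomposition G alpha ap a0 amp am ->
  forall s, ap s = plus_part alpha s.
Proof.
move=> [lin0 _] dec s; rewrite /plus_part dec !wedge1_cons.
have nilp B w : (forall v, B (tangent_tractor v) = 0) ->
    wedge1 B w (map (@tangent_tractor R n) s) = 0.
  move=> B0; rewrite /wedge1 big1 // => i _.
  have lti : (i < size s)%N by rewrite -[X in (_ < X)%N](size_map (@tangent_tractor R n)).
  by rewrite (nth_map 0) // B0 mulr0 mul0r.
have tp v : tmetric G s_plus (tangent_tractor v) = 0 by rewrite tmetric_plus.
have tm v : tmetric G s_minus (tangent_tractor v) = 0 by rewrite tmetric_minus.
rewrite !nilp // tmetric_plus tmetric_minus /= !mul0r mul1r !subr0 !addr0.
have -> : tractor_lift a0 (s_minus :: map (@tangent_tractor R n) s) = 0.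
  have /= := lin0 [::] [seq t.1.2 | t : TV <- map (@tangent_tractor R n) s] 1 0 0.
  by rewrite scale1r addr0 mul1r => /eqP; rewrite -subr_eq0 opprD addrA subrr sub0r
     oppr_eq0 => /eqP.
rewrite addr0 /tractor_lift -map_comp /=.
by congr ap; rewrite -[LHS]map_id; apply: eq_map.
Qed.

End Projection.

(* Main.v *)
Require Import Defs.
From mathcomp Require Import all_boot all_order all_algebra.
From mathcomp Require Import all_classical all_reals all_analysis.
From mathcomp Require Import ring lra.
Require Import Defs.
Import Order.TTheory GRing.Theory Num.Theory.
Import numFieldNormedType.Exports.
Set Implicit Arguments.
Unset Strict Implicit.
Unset Printing Implicit Defensive.
Local Open Scope ring_scope.

(** The tractor metric identifies the parallel 2-form alpha with a skew
    endomorphism E of the tractor bundle, and Clifford multiplication turns the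
    commutator with alpha into the derivation of tractor forms induced by E:
    half of beta . alpha - alpha . beta is the sum over the entries of beta with
    E applied to one entry at a time (clifford_bracket).  Left multiplication by
    alpha is a sum over pairs of basis vectors; right multiplication by alpha
    commutes with all left multiplications, and beta . 1 = beta, so that
    beta . alpha is obtained by letting the right multiplication act on beta.

    The tractor connection preserves the tractor metric, because the Levi-Civita
    connection preserves the metric g (tractor_nabla_metric).  Hence E is
    parallel together with alpha (tractor_nabla_endo), and the Leibniz rule makes
    the derivation of beta parallel (derivation_parallel).  Since changes of
    chart and of metric in the conformal class act on tractors by isometries, they
    intertwine the endomorphisms E (isometry_skew), and half the bracket is a
    parallel section of the tractor (k+1)-forms (Par_half_bracket).  So its
    projection is a nc-Killing form.

    Write f for the function alpha(s_plus, s_minus).  The vector field V of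
    alpha is the tangent part of E s_minus, and the tangent part of the
    parallelism of E at s_minus reads: the covariant derivative of V along X is
    E_0 X + f X, where E_0 is the tangent block of E (nabla_vector_field).  As
    E_0 is skew, V is conformal with factor f.  Substituting this derivative into
    the Lie derivative of beta_+, and the parallelism of beta into the derivative
    along V, each of the k tangent entries contributes E plus f times the
    identity, and the entry s_minus contributes V = E s_minus + f s_minus.  So the
    Lie derivative is the projection of the derivation of beta plus (k+1) f beta_+
    (lie_form_plus), which is the asserted formula.

    The Levi-Civita part needs directional derivatives to be linear in the
    direction; this follows from the mean value theorem for functions that have
    continuous directional derivatives (derive_dir_linear). *)

(** * Exterior algebra *)

Section ExteriorAlgebra.
Context {R : realType} {V : vectType R}.
Implicit Types (w : form V) (xi eta : V -> R) (s : seq V).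

Lemma wedge1_nil xi w : wedge1 xi w [::] = 0.
Proof. by rewrite /wedge1 big_ord0. Qed.

Lemma wedge1D xi w w' s :
  wedge1 xi (fun t => w t + w' t) s = wedge1 xi w s + wedge1 xi w' s.
Proof. by rewrite /wedge1 -big_split; apply: eq_bigr => i _; rewrite mulrDr. Qed.

Lemma wedge1Z xi a w s : wedge1 xi (fun t => a * w t) s = a * wedge1 xi w s.
Proof. by rewrite /wedge1 mulr_sumr; apply: eq_bigr => i _; rewrite mulrCA. Qed.

Lemma wedge1C xi eta w s :
  wedge1 xi (wedge1 eta w) s = - wedge1 eta (wedge1 xi w) s.
Proof.
elim: s w => [|v s IH] w; first by rewrite !wedge1_nil oppr0.
have contr zeta : wedge1 xi (contract v (wedge1 zeta w)) s =
    zeta v * wedge1 xi w s - wedge1 xi (wedge1 zeta (contract v w)) s.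
  rewrite -wedge1Z -wedge1_N -wedge1D; apply: wedge1_ext => t.
  exact: wedge1_cons.
have contr' zeta : wedge1 eta (contract v (wedge1 zeta w)) s =
    zeta v * wedge1 eta w s - wedge1 eta (wedge1 zeta (contract v w)) s.
  rewrite -wedge1Z -wedge1_N -wedge1D; apply: wedge1_ext => t.
  exact: wedge1_cons.
rewrite !wedge1_cons contr contr' IH; ring.
Qed.

Lemma alternatingD w w' :
  alternating w -> alternating w' -> alternating (fun t => w t + w' t).
Proof.
move=> [l z] [l' z']; split=> [s1 s2 a u v|s1 s2 s3 u].
  by rewrite l l'; ring.
by rewrite z z' addr0.
Qed.

Lemma alternatingZ a w : alternating w -> alternating (fun t => a * w t).
Proof.
move=> [l z]; split=> [s1 s2 b u v|s1 s2 s3 u].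
  by rewrite l; ring.
by rewrite z mulr0.
Qed.

Lemma alternating0 : alternating (fun _ : seq V => 0 : R^o).
Proof. by split=> *; rewrite ?mulr0 ?addr0. Qed.

Lemma alternating_sum (I : Type) (r : seq I) (w : I -> form V) :
  (forall i, alternating (w i)) -> alternating (fun t => \sum_(i <- r) w i t).
Proof.
move=> aw; elim: r => [|i r IH].
  have -> : (fun t => \sum_(j <- [::]) w j t) = (fun=> 0 : R^o).
    by apply: funext => t; rewrite big_nil.
  exact: alternating0.
have -> : (fun t => \sum_(j <- i :: r) w j t)
    = (fun t => w i t + \sum_(j <- r) w j t).
  by apply: funext => t; rewrite big_cons.
exact: alternatingD.
Qed.

(** Wedging keeps forms alternating: expanding wedge1 xi w along the first of two
    equal vectors u gives the right-hand side minus the left-hand side. *)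
Lemma wedge1_contract_repeat xi w u s1 s2 : alternating w ->
  wedge1 xi (contract u w) (s1 ++ u :: s2) = xi u * w (s1 ++ u :: s2).
Proof.
elim: s1 w => [|y s1 IH] w aw /=; rewrite wedge1_cons.
  rewrite [wedge1 _ _ _]wedge1_0 ?subr0 // => t; exact: (proj2 aw [::] [::]).
rewrite {1}/contract [w _](proj2 aw [::] s1) mulr0 sub0r.
rewrite -wedge1_N -[in RHS]/(contract y w (s1 ++ u :: s2)).
rewrite -(IH _ (alternating_interior y aw)); apply: wedge1_ext => t.
by rewrite /contract interiorC // opprK.
Qed.

Lemma alternating_wedge1 xi w :
  (forall a u v, xi (a *: u + v) = a * xi u + xi v) ->
  alternating w -> alternating (wedge1 xi w).
Proof.
move=> xil aw; split=> [s1 s2 a u v|s1 s2 s3 u].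
  elim: s1 w aw => [|y s1 IH] w aw /=; rewrite !wedge1_cons.
    have -> : wedge1 xi (contract (a *: u + v) w) s2 =
        a * wedge1 xi (contract u w) s2 + wedge1 xi (contract v w) s2.
      rewrite -wedge1Z -wedge1D; apply: wedge1_ext => t.
      exact: (proj1 aw [::]).
    by rewrite xil; ring.
  rewrite (IH _ (alternating_interior y aw)) (proj1 aw); ring.
elim: s1 w aw => [|y s1 IH] w aw /=; rewrite wedge1_cons.
  by rewrite wedge1_contract_repeat // subrr.
by rewrite (IH _ (alternating_interior y aw)) (proj2 aw) mulr0 subr0.
Qed.

Lemma alternating_form_one : alternating (@form_one R V).
Proof.
split=> [s1 s2 a u v|s1 s2 s3 u]; last by case: s1.
by case: s1 => [|? ?] /=; rewrite mulr0 addr0.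
Qed.

Lemma set_nth_cat s m u : (m < size s)%N ->
  set_nth 0 s m u = take m s ++ u :: drop m.+1 s.
Proof.
elim: s m => [//|v s IH] [|m] /=; first by rewrite drop0.
by rewrite ltnS => /IH ->.
Qed.

Lemma alternating_set_nth w s m : alternating w -> (m < size s)%N ->
  forall a u v, w (set_nth 0 s m (a *: u + v)) =
    a * w (set_nth 0 s m u) + w (set_nth 0 s m v).
Proof. by move=> aw lt a u v; rewrite !set_nth_cat // (proj1 aw). Qed.

Lemma alternating_set_nth0 w s m : alternating w -> (m < size s)%N ->
  w (set_nth 0 s m 0) = 0.
Proof.
move=> aw lt; have := alternating_set_nth aw lt (-1) 0 0.
by rewrite scaler0 addr0 mulN1r addNr.
Qed.

Lemma alternating_set_nth_sum w s m (I : Type) (r : seq I) (k : I -> R)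
    (u : I -> V) : alternating w -> (m < size s)%N ->
  w (set_nth 0 s m (\sum_(i <- r) k i *: u i)) =
    \sum_(i <- r) k i * w (set_nth 0 s m (u i)).
Proof.
move=> aw lt; elim: r => [|i r IH]; first by rewrite !big_nil alternating_set_nth0.
by rewrite !big_cons alternating_set_nth // IH.
Qed.

(** Wedging with xi after contracting with u is the derivation induced by the
    rank one endomorphism v |-> xi v *: u. *)
Lemma wedge1_contract xi w u s : alternating w ->
  wedge1 xi (contract u w) s = \sum_(m < size s) xi s`_m * w (set_nth 0 s m u).
Proof.
elim: s w => [|v s IH] w aw; first by rewrite wedge1_nil big_ord0.
rewrite wedge1_cons big_ord_recl /=; congr (_ + _).
rewrite -(IH _ (alternating_interior v aw)) -wedge1_N; apply: wedge1_ext => t.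
by rewrite /contract interiorC // opprK.
Qed.

End ExteriorAlgebra.

(** * Clifford multiplication *)

Section CliffordAlgebra.
Context {R : realType} {V : vectType R}.
Variable B : V -> V -> R.
Hypothesis Bl : forall w a u v, B (a *: u + v) w = a * B u w + B v w.
Hypothesis Bsym : forall u v, B u v = B v u.
Implicit Types (w : form V) (s : seq V) (es : seq V).

Lemma bilin_r z a u v : B z (a *: u + v) = a * B z u + B z v.
Proof. by rewrite ![B z _]Bsym Bl. Qed.

Lemma bilin0l z : B 0 z = 0.
Proof.
by have := Bl z (-1) 0 0; rewrite scaler0 addr0 mulN1r addNr.
Qed.

Lemma bilin_sumr z (I : Type) (r : seq I) (k : I -> R) (u : I -> V) :
  B z (\sum_(i <- r) k i *: u i) = \sum_(i <- r) k i * B z (u i).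
Proof.
elim: r => [|i r IH]; first by rewrite !big_nil Bsym bilin0l.
by rewrite !big_cons bilin_r IH.
Qed.

(** Right Clifford multiplication by a vector, up to the grading sign. *)
Definition clmulr (v : V) w : form V :=
  fun s => wedge1 (B v) w s + contract v w s.

Lemma alternating_clmul v w : alternating w -> alternating (clmul B v w).
Proof.
move=> aw.
have -> : clmul B v w = fun s => wedge1 (B v) w s + (-1) * contract v w s.
  by apply: funext => s; rewrite mulN1r.
apply: alternatingD; first exact: alternating_wedge1 (bilin_r v) aw.
exact/alternatingZ/alternating_interior.
Qed.

Lemma alternating_clmulr v w : alternating w -> alternating (clmulr v w).
Proof.
move=> aw; apply: alternatingD; first exact: alternating_wedge1 (bilin_r v) aw.
exact: alternating_interior.
Qed.

Lemma clmul_ext v w w' s : (forall t, w t = w' t) -> clmul B v w s = clmul B v w' s.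
Proof. by move=> h; rewrite /clmul (wedge1_ext _ _ h) /contract h. Qed.

Lemma clmulD v w w' s :
  clmul B v (fun t => w t + w' t) s = clmul B v w s + clmul B v w' s.
Proof. by rewrite /clmul wedge1D /contract; ring. Qed.

Lemma clmulZ v a w s : clmul B v (fun t => a * w t) s = a * clmul B v w s.
Proof. by rewrite /clmul wedge1Z /contract; ring. Qed.

Lemma clmul0 v s : clmul B v (fun=> 0) s = 0.
Proof. by rewrite /clmul wedge1_0 // /contract subrr. Qed.

Lemma clmul_sum v (I : Type) (r : seq I) (P : pred I) (w : I -> form V) s :
  clmul B v (fun t => \sum_(i <- r | P i) w i t) s =
    \sum_(i <- r | P i) clmul B v (w i) s.
Proof.
elim: r => [|i r IH].
  by rewrite big_nil -[RHS](clmul0 v s); apply: clmul_ext => t; rewrite big_nil.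
rewrite big_cons -IH; case: ifP => Pi; last first.
  by apply: clmul_ext => t; rewrite big_cons Pi.
by rewrite -clmulD; apply: clmul_ext => t; rewrite big_cons Pi.
Qed.

Lemma wedge1_clmul xi v w s :
  wedge1 xi (clmul B v w) s = wedge1 xi (wedge1 (B v) w) s - wedge1 xi (contract v w) s.
Proof. by rewrite -wedge1_N -wedge1D. Qed.

Lemma wedge1_clmulr xi v w s :
  wedge1 xi (clmulr v w) s = wedge1 xi (wedge1 (B v) w) s + wedge1 xi (contract v w) s.
Proof. by rewrite -wedge1D. Qed.

(** The Clifford relation. *)
Lemma clmulC u v w s : alternating w ->
  clmul B u (clmul B v w) s = - clmul B v (clmul B u w) s - 2 * B u v * w s.
Proof.
move=> aw; rewrite [LHS]/clmul wedge1_clmul [in RHS]/clmul wedge1_clmul.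
rewrite /contract /= /clmul !wedge1_cons -/(contract _ _) (Bsym v u).
by rewrite (wedge1C (B u)) /contract (interiorC u v s aw); ring.
Qed.

(** Left and right multiplications commute; the sign is the grading sign that
    clmulr omits, so pairs of right multiplications commute with clmul. *)
Lemma clmul_clmulr u v w s : alternating w ->
  clmul B u (clmulr v w) s = - clmulr v (clmul B u w) s.
Proof.
move=> aw; rewrite [LHS]/clmul wedge1_clmulr [in RHS]/clmulr wedge1_clmul.
rewrite /contract /= /clmul /clmulr !wedge1_cons -/(contract _ _) (Bsym v u).
by rewrite (wedge1C (B u)) /contract (interiorC u v s aw); ring.
Qed.

Lemma clmulr_ext v w w' s : (forall t, w t = w' t) -> clmulr v w s = clmulr v w' s.
Proof. by move=> h; rewrite /clmulr (wedge1_ext _ _ h) /contract h. Qed.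

Lemma clmulrD v w w' s :
  clmulr v (fun t => w t + w' t) s = clmulr v w s + clmulr v w' s.
Proof. by rewrite /clmulr wedge1D /contract; ring. Qed.

Lemma clmulrZ v a w s : clmulr v (fun t => a * w t) s = a * clmulr v w s.
Proof. by rewrite /clmulr wedge1Z /contract; ring. Qed.

Lemma clmul_clmulr2 u v v' w s : alternating w ->
  clmul B u (clmulr v (clmulr v' w)) s = clmulr v (clmulr v' (clmul B u w)) s.
Proof.
move=> aw; rewrite clmul_clmulr; last exact: alternating_clmulr.
rewrite -mulN1r -clmulrZ; apply: clmulr_ext => t.
by rewrite clmul_clmulr // mulN1r opprK.
Qed.

(** A recursion over the list in place of the sum over its subsets: each vector
    in turn either takes part or does not.  Statements about products then follow
    by induction on the list. *)
Fixpoint clifford_sum es (a b : form V) : form V :=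
  if es is e :: es' then fun s =>
    clifford_sum es' a b s
    + B e e * clmul B e (clifford_sum es' (contract e a) b) s
  else fun s => a [::] * b s.

Lemma clifford_sum_ext es a a' b b' s : (forall t, a t = a' t) ->
  (forall t, b t = b' t) -> clifford_sum es a b s = clifford_sum es a' b' s.
Proof.
move=> /funext -> /funext -> //.
Qed.

(** A subset of the index set is its part in the tail of the enumeration, with
    or without the first index. *)
Lemma clifford_inE (e : (\dim {:V}).-tuple V) a b s :
  clifford_in B e a b s = clifford_sum e a b s.
Proof.
suff gen (l : seq 'I_(\dim {:V})) : uniq l -> forall a s,
    \sum_(I : {set 'I_(\dim {:V})} | I \subset l)
      (let eI := [seq tnth e i | i <- l & i \in I] in
       (\prod_(i in I) B (tnth e i) (tnth e i)) * a eI * foldr (clmul B) b eI s)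
    = clifford_sum (map (tnth e) l) a b s.
  rewrite -[X in clifford_sum X]map_tnth_enum -gen ?enum_uniq //.
  apply: eq_big => [I|I _].
    by apply/esym/fintype.subsetP => i _; rewrite mem_enum.
  rewrite /= (_ : [seq i <- enum 'I_(\dim {:V}) | i \in I] = enum I) //.
  by rewrite /enum_mem -filter_predI; apply: eq_filter => i; rewrite /= andbT.
elim: l => [_|i l IH /= /andP[il ul]] {}a {}s.
  rewrite (big_pred1 finset.set0) => [|I] /=.
    by rewrite big_set0 mul1r.
  rewrite -finset.subset0; apply/idP/idP => /fintype.subsetP sI;
    by apply/fintype.subsetP => j /sI; rewrite inE.
rewrite (bigID (fun I : {set _} => i \in I)) /= addrC; congr (_ + _).
  rewrite -IH //; apply: eq_big => [I|I].
    apply/andP/fintype.subsetP => [[/fintype.subsetP sI iI] j jI|sI].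
      by move: (sI j jI); rewrite inE => /predU1P[ji|//]; rewrite -ji jI in iI.
    split; first by apply/fintype.subsetP => j /sI; rewrite inE => ->; rewrite orbT.
    by apply: contra il => /sI.
  by move=> /andP[_ /negbTE ->].
rewrite -(clmul_ext _ _ (IH ul (contract (tnth e i) a))) clmul_sum mulr_sumr.
rewrite (reindex_onto (fun J => i |: J) (fun I => I :\ i)) /=; last first.
  by move=> I /andP[_ iI]; rewrite finset.setD1K.
have cond (J : {set 'I_(\dim {:V})}) :
    [&& (i |: J) \subset i :: l, i \in i |: J & (i |: J) :\ i == J] = (J \subset l).
  rewrite !inE eqxx /=.
  apply/andP/fintype.subsetP => [[/fintype.subsetP sJ /eqP dJ] j jJ|sJ].
    move: jJ (sJ j); rewrite -{1}dJ !inE => /andP[/negbTE nji ->].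
    by rewrite nji /= => ->.
  split; first by apply/fintype.subsetP => j; rewrite !inE => /orP[->//|/sJ ->]; rewrite orbT.
  by apply/eqP/finset.setU1K; apply: contra il => /sJ.
apply: eq_big => [J|J]; first by rewrite -cond -andbA.
rewrite -andbA cond => sJ.
have iJ : i \notin J by apply: contra il => /(fintype.subsetP sJ).
rewrite big_setU1 //= finset.setU11 /= clmulZ.
have -> : [seq j <- l | j \in i |: J] = [seq j <- l | j \in J].
  apply: eq_in_filter => j jl; rewrite !inE; case: eqP => //= ji.
  by rewrite -ji jl in il.
by rewrite /contract /=; ring.
Qed.

Lemma alternating_clifford_sum es a b :
  alternating b -> alternating (clifford_sum es a b).
Proof.
move=> ab; elim: es a => [|e es IH] a /=; first exact: alternatingZ.
apply: alternatingD; first exact: IH.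
exact/alternatingZ/alternating_clmul.
Qed.

Lemma clifford_sum0 es a b s : (forall t, a t = 0) -> clifford_sum es a b s = 0.
Proof.
elim: es a s => [|e es IH] a s a0 /=; first by rewrite a0 mul0r.
rewrite IH // (clmul_ext e s (w' := fun=> 0)) ?clmul0 ?mulr0 ?addr0 //.
by move=> t; apply: IH => u; exact: a0.
Qed.

Lemma clifford_sum_scalar es a b s : (forall t, size t <> 0 -> a t = 0) ->
  clifford_sum es a b s = a [::] * b s.
Proof.
move=> a0; elim: es s => //= e es IH s; rewrite IH.
rewrite (clmul_ext e s (w' := fun=> 0)) ?clmul0 ?mulr0 ?addr0 // => t.
by apply: clifford_sum0 => u; exact: a0.
Qed.

Lemma clifford_sum_vector es a b s : (forall t, size t <> 1%N -> a t = 0) ->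
  clifford_sum es a b s = \sum_(e <- es) B e e * a [:: e] * clmul B e b s.
Proof.
move=> a1; elim: es s => [|e es IH] s /=; first by rewrite big_nil a1 // mul0r.
rewrite big_cons addrC IH; congr (_ + _); rewrite -mulrA; congr (_ * _); rewrite -clmulZ.
apply: clmul_ext => t; rewrite clifford_sum_scalar // => u su.
by apply: a1 => /= -[].
Qed.

(** For a 2-form the sum over two-element subsets is half the sum over ordered
    pairs, because orthogonal vectors anticommute. *)
Lemma clifford_sum_two es a b s : alternating b -> is_form 2 a ->
  pairwise (fun u v => B u v == 0) es ->
  clifford_sum es a b s = 2^-1 * \sum_(e <- es) \sum_(f <- es)
    B e e * B f f * a [:: e; f] * clmul B e (clmul B f b) s.
Proof.
move=> ab [aa a2]; elim: es s => [|e es IH] s /=.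
  by rewrite !big_nil a2 // mul0r mulr0.
case/andP=> /allP oe oes; rewrite IH // big_cons.
have a1 : forall t, size t <> 1%N -> contract e a t = 0.
  by move=> t st; apply: a2 => /= -[].
rewrite (clmul_ext e s (clifford_sum_vector es b ^~ a1)) clmul_sum.
have aee : a [:: e; e] = 0 by exact: (proj2 aa [::] [::] [::]).
rewrite big_cons aee mulr0 mul0r add0r.
have -> : \sum_(j <- es) \sum_(f <- (e :: es))
      B j j * B f f * a [:: j; f] * clmul B j (clmul B f b) s
    = \sum_(f <- es) B e e * B f f * a [:: e; f] * clmul B e (clmul B f b) s
      + \sum_(j <- es) \sum_(f <- es)
          B j j * B f f * a [:: j; f] * clmul B j (clmul B f b) s.
  rewrite -big_split /= !big_seq; apply: eq_bigr => j jes.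
  rewrite big_cons; congr (_ + _).
  rewrite interiorC // (clmulC j e) // (Bsym j e) (eqP (oe j jes)); ring.
rewrite [X in _ + _ * X](eq_bigr (fun f => B f f * a [:: e; f]
    * clmul B e (clmul B f b) s)); last first.
  by move=> f _; rewrite clmulZ.
have -> : \sum_(f <- es) B e e * B f f * a [:: e; f] * clmul B e (clmul B f b) s
    = B e e * \sum_(f <- es) B f f * a [:: e; f] * clmul B e (clmul B f b) s.
  by rewrite mulr_sumr; apply: eq_bigr => f _; ring.
set S2 := \sum_(f <- es) B f f * _ * _; set S1 := \sum_(f <- es) \sum_(f0 <- es) _.
by field.
Qed.

(** Right Clifford multiplication by the 2-form a.  The minus sign is the
    product of the two grading signs that clmulr omits. *)
Definition clifford_right2 es (a w : form V) : form V := fun s =>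
  - 2^-1 * \sum_(e <- es) \sum_(f <- es)
    B e e * B f f * a [:: e; f] * clmulr f (clmulr e w) s.

Lemma clmul_right2 u es a w s : alternating w ->
  clmul B u (clifford_right2 es a w) s = clifford_right2 es a (clmul B u w) s.
Proof.
move=> aw; rewrite /clifford_right2 clmulZ clmul_sum; congr (_ * _).
apply: eq_bigr => e _; rewrite clmul_sum; apply: eq_bigr => f _.
by rewrite clmulZ clmul_clmulr2.
Qed.

Lemma clifford_right2D es a w w' s : clifford_right2 es a (fun t => w t + w' t) s
  = clifford_right2 es a w s + clifford_right2 es a w' s.
Proof.
rewrite /clifford_right2 -mulrDr -big_split; congr (_ * _).
apply: eq_bigr => e _; rewrite -big_split; apply: eq_bigr => f _ /=.
rewrite -mulrDr -clmulrD; congr (_ * _); apply: clmulr_ext => t.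
exact: clmulrD.
Qed.

Lemma clifford_right2Z es a k w s : clifford_right2 es a (fun t => k * w t) s
  = k * clifford_right2 es a w s.
Proof.
rewrite /clifford_right2 mulrCA !mulr_sumr.
apply: eq_bigr => e _; rewrite !mulr_sumr; apply: eq_bigr => f _ /=.
rewrite (clmulr_ext f s (clmulrZ e k w)) clmulrZ; ring.
Qed.

Lemma clifford_right2_ext es a w w' s : (forall t, w t = w' t) ->
  clifford_right2 es a w s = clifford_right2 es a w' s.
Proof. by move=> /funext ->. Qed.

(** Associativity of the Clifford product, for a 2-form on the right. *)
Lemma clifford_sum_right2 es es' a b w s : alternating w ->
  clifford_sum es b (clifford_right2 es' a w) s
  = clifford_right2 es' a (clifford_sum es b w) s.
Proof.
move=> aw; elim: es b s => [|e es IH] b s /=; first by rewrite clifford_right2Z.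
rewrite clifford_right2D clifford_right2Z IH; congr (_ + _ * _).
rewrite -clmul_right2; last exact: alternating_clifford_sum.
by apply: clmul_ext => t; exact: IH.
Qed.

(** Both sides are the Clifford product of e and f, computed from the left and
    from the right. *)
Lemma clmulr2_one e f s :
  clmul B e (clmul B f (@form_one R V)) s = - clmulr f (clmulr e (@form_one R V)) s.
Proof.
rewrite [LHS]/clmul [in RHS]/clmulr wedge1_clmul wedge1_clmulr.
have w0 xi u t : wedge1 xi (contract u (@form_one R V)) t = 0 by apply: wedge1_0.
rewrite !w0 !subr0 !addr0 wedge1C /contract /clmul /clmulr !wedge1_cons !w0.
by rewrite (Bsym f e); rewrite /contract /=; ring.
Qed.

(** Acting on the constant form 1, orthogonal vectors have nothing to contract
    with, so that their Clifford product is their wedge product. *)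
Lemma contract_clifford_sum_one es a u s : (forall v, v \in es -> B u v = 0) ->
  clifford_sum es a (@form_one R V) (u :: s) = 0.
Proof.
elim: es a s => [|e es IH] a s ou /=; first by rewrite mulr0.
have ou' v : v \in es -> B u v = 0 by move=> ves; apply: ou; rewrite inE ves orbT.
rewrite IH // add0r /clmul wedge1_cons Bsym ou ?mem_head // mul0r sub0r.
rewrite wedge1_0; last by move=> t; exact: IH.
rewrite /contract interiorC; last exact/alternating_clifford_sum/alternating_form_one.
by rewrite IH // oppr0 subr0 mulr0.
Qed.

Definition orthoproj es (u : V) : V := \sum_(e <- es) (B e e * B e u) *: e.

Definition orthonormal_seq es :=
  pairwise (fun u v => B u v == 0) es && all (fun u => (B u u) ^+ 2 == 1) es.

Lemma orthoproj_linear es k u v : orthoproj es (k *: u + v) = k *: orthoproj es u + orthoproj es v.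
Proof.
rewrite /orthoproj scaler_sumr -big_split; apply: eq_bigr => e _ /=.
by rewrite bilin_r scalerA -scalerDl; congr (_ *: _); ring.
Qed.

Lemma orthoproj_orth es u : (forall v, v \in es -> B u v = 0) -> orthoproj es u = 0.
Proof.
move=> ou; rewrite /orthoproj big_seq big1 // => e ees.
by rewrite [B e u]Bsym ou // mulr0 scale0r.
Qed.

(** The expansion of a form in an orthonormal family; it determines a only on
    the span of the family, hence the projection on the right. *)
Lemma clifford_sum_one es a s : orthonormal_seq es -> alternating a ->
  clifford_sum es a (@form_one R V) s = a (map (orthoproj es) s).
Proof.
elim: es a s => [|e es IH] a s /=.
  move=> _ aa; case: s => [|v s] /=; first by rewrite mulr1.
  rewrite mulr0 /orthoproj big_nil.
  by have /= := alternating_set_nth0 (s := 0 :: map (fun=> 0) s) (m := 0) aa isT;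
     move=> <-; congr (a (_ :: _)); apply: eq_map => u; rewrite big_nil.
case/andP=> /andP[/allP oe pes] /andP[/eqP ne nes] aa.
have oes : orthonormal_seq es by apply/andP.
have oe' v : v \in es -> B e v = 0 by move=> /oe /eqP.
have pe : orthoproj (e :: es) e = e.
  by rewrite /orthoproj big_cons -expr2 ne scale1r -/(orthoproj es e) orthoproj_orth // addr0.
have pc u : orthoproj (e :: es) u = (B e e * B e u) *: e + orthoproj es u.
  by rewrite /orthoproj big_cons.
have ap : alternating (fun t => a (map (orthoproj (e :: es)) t)).
  exact: alternating_map (orthoproj_linear _) aa.
have Bep u : B e (orthoproj es u) = 0.
  rewrite /orthoproj bilin_sumr big_seq big1 // => v ves.
  by rewrite oe' // mulr0.
rewrite IH // [RHS](split_form (fun u => B e e * B e u) e s ap) addrC.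
congr (_ + _); last first.
  rewrite -map_comp; congr a; apply: eq_map => u /=.
  rewrite -scaleNr addrC orthoproj_linear pe pc addrA -scalerDl addNr scale0r.
  by rewrite add0r.
rewrite /clmul (wedge1_ext (B e) s (fun t => IH _ t oes (alternating_interior e aa))).
rewrite [contract e _ s]contract_clifford_sum_one // subr0.
rewrite [RHS](_ : _ = B e e * wedge1 (B e)
    (contract e (fun t => a (map (orthoproj (e :: es)) t))) s); last first.
  by rewrite /wedge1 mulr_sumr; apply: eq_bigr => i _; rewrite !mulrA [in LHS]mulrAC;
     ring.
congr (_ * _); apply: wedge1_ext => t; rewrite /contract /= pe.
rewrite [RHS](split_form (fun u => B e e * B e u) e _ (alternating_interior e aa)).
rewrite wedge1_0 ?add0r; last by move=> u; exact: (proj2 aa [::] [::]).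
rewrite -map_comp /contract; congr (a (_ :: _)); apply: eq_map => u /=.
rewrite pc bilin_r Bep addr0 mulrA -mulrA -mulrA [B e u * _]mulrC mulrA.
by rewrite -[X in _ - (X * _) *: _]expr2 ne mul1r addrC addKr.
Qed.

Section OrthonormalBasis.
Variable e : (\dim {:V}).-tuple V.
Hypothesis eB : pseudo_orthonormal B e.

Lemma pseudo_orthonormal_sq i : B (tnth e i) (tnth e i) ^+ 2 = 1.
Proof. by case: eB => _ _ /(_ i)[] ->; rewrite ?sqrrN expr1n. Qed.

Lemma pseudo_orthonormal_seq : orthonormal_seq e.
Proof.
case: eB => _ oe _; apply/andP; split; last first.
  by apply/allP => _ /tnthP[i ->]; apply/eqP/pseudo_orthonormal_sq.
rewrite -[X in pairwise _ X]map_tnth_enum pairwise_map.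
have := enum_uniq 'I_(\dim {:V}); rewrite uniq_pairwise.
by apply: sub_pairwise => i j /= /oe /eqP.
Qed.

Lemma orthoproj_basis u : orthoproj e u = u.
Proof.
have [be oe _] := eB.
rewrite {2}(coord_basis be (memvf u)) /orthoproj big_tuple; apply: eq_bigr => i _.
rewrite -tnth_nth; congr (_ *: _).
rewrite {1}(coord_basis be (memvf u)) bilin_sumr (bigD1 i) //= -tnth_nth.
rewrite big1 ?addr0 => [|j ji]; last by rewrite -tnth_nth oe ?mulr0 // eq_sym.
by rewrite mulrCA -expr2 pseudo_orthonormal_sq mulr1.
Qed.

Lemma clifford_in_one a s : alternating a -> clifford_in B e a (@form_one R V) s = a s.
Proof.
move=> aa; rewrite clifford_inE clifford_sum_one ?pseudo_orthonormal_seq //.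
by rewrite (eq_map orthoproj_basis) map_id.
Qed.

(** Writing a as the right product 1 . a reduces b . a to right multiplication,
    since b . 1 = b. *)
Lemma clifford_in_right2 a b s : alternating b -> is_form 2 a ->
  clifford_in B e b a s = clifford_right2 e a b s.
Proof.
move=> ab fa; have [aa _] := fa.
have /andP[pe _] := pseudo_orthonormal_seq.
have aE t : a t = clifford_right2 e a (@form_one R V) t.
  rewrite -[LHS](clifford_in_one t aa) clifford_inE.
  rewrite (clifford_sum_two t alternating_form_one fa pe) /clifford_right2.
  rewrite mulNr -mulrN -sumrN; congr (_ * _); apply: eq_bigr => u _.
  rewrite -sumrN; apply: eq_bigr => v _.
  by rewrite clmulr2_one mulrN.
rewrite clifford_inE (clifford_sum_ext e s (fun=> erefl) aE).
rewrite clifford_sum_right2; last exact: alternating_form_one.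
apply: clifford_right2_ext => t.
by rewrite -clifford_inE clifford_in_one.
Qed.

Lemma clmulr_sub_clmul u v w s : alternating w ->
  - clmulr v (clmulr u w) s - clmul B u (clmul B v w) s
  = 2 * (wedge1 (B u) (contract v w) s - wedge1 (B v) (contract u w) s).
Proof.
move=> aw; rewrite [clmulr v _ s]/clmulr [clmul B u _ s]/clmul.
rewrite wedge1_clmul wedge1_clmulr /contract /clmul /clmulr !wedge1_cons.
by rewrite (Bsym v u) (wedge1C (B u)) /contract (interiorC u v s aw); ring.
Qed.

(** Both products by a are sums over pairs of basis vectors; in their difference
    the double wedges and double contractions cancel and the mixed terms add up. *)
Lemma clifford_in_bracket a b s : alternating b -> is_form 2 a ->
  clifford_in B e b a s - clifford_in B e a b s
  = 2 * \sum_(u <- e) \sum_(v <- e) B u u * B v v * a [:: u; v]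
          * wedge1 (B u) (contract v b) s.
Proof.
move=> ab fa; have [aa _] := fa.
have /andP[pe _] := pseudo_orthonormal_seq.
rewrite clifford_in_right2 // clifford_inE (clifford_sum_two s ab fa pe).
rewrite /clifford_right2.
set S := \sum_(u <- e) \sum_(v <- e) _ * wedge1 _ _ _.
have S' : \sum_(u <- e) \sum_(v <- e) B u u * B v v * a [:: u; v]
          * wedge1 (B v) (contract u b) s = - S.
  rewrite exchange_big /= -sumrN; apply: eq_bigr => u _.
  rewrite -sumrN; apply: eq_bigr => v _.
  by rewrite interiorC //; ring.
set T1 := \sum_(u <- e) _; set T2 := \sum_(u <- e) _.
have TE : - T1 - T2 = 2 * (S - - S).
  rewrite -S' -sumrN -!sumrB mulr_sumr; apply: eq_bigr => u _.
  rewrite -sumrN -!sumrB mulr_sumr; apply: eq_bigr => v _.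
  rewrite -mulrBr mulrCA -clmulr_sub_clmul //; ring.
rewrite (_ : _ - _ = 2^-1 * (- T1 - T2)); last by ring.
by rewrite TE; field.
Qed.

Lemma alternating_clifford_in_bracket a b : alternating b -> is_form 2 a ->
  alternating (fun s => clifford_in B e b a s - clifford_in B e a b s).
Proof.
move=> ab fa; rewrite (funext (fun s => clifford_in_bracket s ab fa)).
apply: alternatingZ.
apply: (alternating_sum _ (w := fun u s => \sum_(v <- e)
  B u u * B v v * a [:: u; v] * wedge1 (B u) (contract v b) s)) => u.
apply: (alternating_sum _ (w := fun v s =>
  B u u * B v v * a [:: u; v] * wedge1 (B u) (contract v b) s)) => v.
apply: (alternatingZ _ (w := wedge1 (B u) (contract v b))).
apply: alternating_wedge1 (bilin_r u) _.
exact: alternating_interior.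
Qed.

End OrthonormalBasis.

Lemma xget_pseudo_orthonormal : (exists e, pseudo_orthonormal B e) ->
  pseudo_orthonormal B (xget (nseq_tuple _ 0) [set e | pseudo_orthonormal B e]%classic).
Proof. exact: (@xgetPex _ _ [set e | pseudo_orthonormal B e]%classic). Qed.

(** The mixed terms wedge e_i after contracting with e_j; by wedge1_contract they
    replace one entry at a time, and the sum over the basis assembles A. *)
Lemma clifford_bracket a b (A : V -> V) s : (exists e, pseudo_orthonormal B e) ->
  is_form 2 a -> alternating b -> (forall t u, B (A t) u = a [:: t; u]) ->
  clifford B b a s - clifford B a b s
  = 2 * \sum_(m < size s) b (set_nth 0 s m (A s`_m)).
Proof.
move=> /xget_pseudo_orthonormal; rewrite /clifford.
set e := xget _ _ => eB fa ab hA; rewrite clifford_in_bracket //; congr (_ * _).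
under eq_bigr => u _ do under eq_bigr => v _ do rewrite wedge1_contract // mulr_sumr.
under eq_bigr => u _ do rewrite exchange_big /=.
rewrite exchange_big /=; apply: eq_bigr => m _.
rewrite exchange_big /= -[in RHS](orthoproj_basis eB (A s`_m)) alternating_set_nth_sum //.
apply: eq_bigr => v _.
rewrite [B v (A _)]Bsym hA -[in RHS](orthoproj_basis eB s`_m) /orthoproj.
have aE : a [:: \sum_(u <- e) (B u u * B u s`_m) *: u; v]
    = \sum_(u <- e) (B u u * B u s`_m) * a [:: u; v].
  exact: (alternating_set_nth_sum (s := [:: 0; v]) (m := 0) e _ id (proj1 fa) isT).
rewrite aE mulr_sumr mulr_suml; apply: eq_bigr => u _; ring.
Qed.

Lemma alternating_clifford_bracket a b : (exists e, pseudo_orthonormal B e) ->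
  is_form 2 a -> alternating b ->
  alternating (fun s => clifford B b a s - clifford B a b s).
Proof.
by move=> /xget_pseudo_orthonormal eB fa ab; exact: alternating_clifford_in_bracket.
Qed.

Lemma orthonormal_tuple_basis (e : (\dim {:V}).-tuple V) :
  (forall i j, i != j -> B (tnth e i) (tnth e j) = 0) ->
  (forall i, B (tnth e i) (tnth e i) = 1 \/ B (tnth e i) (tnth e i) = -1) ->
  pseudo_orthonormal B e.
Proof.
move=> oe ne; split=> //; rewrite basisEfree subvf size_tuple leqnn !andbT.
apply/freeP => k k0 i.
have := congr1 (B (tnth e i)) k0; rewrite bilin_sumr Bsym bilin0l (bigD1 i) //= big1.
  rewrite addr0 -tnth_nth => /eqP; rewrite mulf_eq0 => /orP[/eqP //|].
  by case: (ne i) => ->; rewrite ?oppr_eq0 oner_eq0.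
by move=> j ji; rewrite -tnth_nth oe ?mulr0 // eq_sym.
Qed.

End CliffordAlgebra.

(** An isometry maps an orthonormal basis to an orthonormal basis, and a vector
    is determined by its pairings with such a basis. *)
Lemma isometry_skew (R : realType) (V : vectType R) (B B' : V -> V -> R)
    (tau A A' : V -> V) (a a' : form V) :
  (forall z k u v, B' (k *: u + v) z = k * B' u z + B' v z) ->
  (forall u v, B' u v = B' v u) ->
  (exists e, pseudo_orthonormal B e) ->
  (forall u v, B' (tau u) (tau v) = B u v) ->
  (forall t u, B (A t) u = a [:: t; u]) ->
  (forall t u, B' (A' t) u = a' [:: t; u]) ->
  (forall t u, a' [:: tau t; tau u] = a [:: t; u]) ->
  forall t, A' (tau t) = tau (A t).
Proof.
move=> Bl' Bsym' [e [be oe ne]] iso hA hA' aa' t.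
have e'B : pseudo_orthonormal B' (map_tuple tau e).
  apply: (orthonormal_tuple_basis Bl' Bsym') => [i j ij|i].
    by rewrite !tnth_map iso oe.
  by rewrite !tnth_map iso.
apply/eqP; rewrite -subr_eq0; apply/eqP.
rewrite -[LHS](orthoproj_basis Bl' Bsym' e'B) orthoproj_orth // => v /tnthP[i ->].
rewrite tnth_map addrC -scaleN1r Bl' hA' iso hA aa'; ring.
Qed.

(** The action of an endomorphism on forms as a derivation; on covectors it is
    the transpose of E. *)
Definition derivation {R : realType} {V : vectType R} (E : V -> V) (b : form V)
    : form V :=
  fun s => \sum_(m < size s) b (set_nth 0 s m (E s`_m)).

Lemma derivation_map (R : realType) (V : vectType R) (tau E E' : V -> V)
    (b b' : form V) s : (forall t, E' (tau t) = tau (E t)) ->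
  (forall s, b s = b' (map tau s)) -> derivation E b s = derivation E' b' (map tau s).
Proof.
move=> EE bb; rewrite /derivation size_map; apply: eq_bigr => m _.
rewrite bb !set_nth_cat ?size_map // map_cat /= map_take map_drop.
by rewrite (nth_map 0) // EE.
Qed.

(** * Directional derivatives *)

Local Open Scope classical_set_scope.
Local Open Scope ring_scope.

Section DirectionalDerivative.
Context {R : realType} {n : nat}.
Local Notation E := 'rV[R]_n.
Implicit Types (f : E -> R^o) (U : set E).

Lemma derive_line f (u z : E) t :
  (fun h => h^-1 *: (((fun s : R^o => f (s *: u + z)) \o shift t) (h *: 1)
                     - f (t *: u + z)))
  = (fun h => h^-1 *: ((f \o shift (t *: u + z)) (h *: u) - f (t *: u + z))).
Proof.
apply: funext => h /=; congr (_ *: (f _ - _)).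
by rewrite [h *: 1]mulr1 scalerDl addrA.
Qed.

Lemma MVT_line f (u z : E) (c : R) :
  (forall t, `|t| <= `|c| -> derivable f (t *: u + z) u) ->
  exists2 t, `|t| <= `|c| & f (c *: u + z) - f z = c * 'D_u f (t *: u + z).
Proof.
move=> df; pose phi (s : R) : R := f (s *: u + z).
have dphi t : `|t| <= `|c| -> is_derive (t : R^o) 1 (phi : R^o -> R^o) ('D_u f (t *: u + z)).
  move=> tc; have := df t tc; rewrite /derivable -derive_line => d.
  by apply: DeriveDef; [exact: d | rewrite /derive -derive_line].
have phi0 : phi 0 = f z by rewrite /phi scale0r add0r.
have cphi a b : (forall t, a <= t <= b -> `|t| <= `|c|) ->
    {within `[a, b], continuous phi}.
  move=> h; apply: derivable_within_continuous => t; rewrite in_itv /= => /h tc.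
  exact: (@ex_derive _ _ _ _ _ _ _ (dphi t tc)).
have [c0|c0] := leP 0 c.
  have ht t : 0 <= t <= c -> `|t| <= `|c|.
    by move=> /andP[t0 tc]; rewrite !ger0_norm.
  have [|t tin] := @MVT_segment _ phi (fun t => 'D_u f (t *: u + z)) 0 c c0 _ (cphi 0 c ht).
    move=> t; rewrite in_itv /= => /andP[t0 tc].
    by apply: dphi; apply: ht; rewrite !ltW.
  rewrite phi0 subr0 mulrC => eq; exists t => //.
  by move: tin; rewrite in_itv /= => /ht.
have ht t : c <= t <= 0 -> `|t| <= `|c|.
  by move=> /andP[t0 tc]; rewrite !ler0_norm ?(ltW c0) // lerN2.
have [|t tin] := @MVT_segment _ phi (fun t => 'D_u f (t *: u + z)) c 0 (ltW c0) _ (cphi c 0 ht).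
  move=> t; rewrite in_itv /= => /andP[t0 tc].
  by apply: dphi; apply: ht; rewrite !ltW.
rewrite phi0 sub0r => eq; exists t; first by move: tin; rewrite in_itv /= => /ht.
by rewrite -opprB eq /phi; ring.
Qed.

(** The directional derivative of a function with a continuous derivative along
    u is additive in u: along the broken path from x to x + h v and then to
    x + h v + h a u, the last piece is governed by the mean value theorem. *)
Lemma derive_dir_linear f (x u v : E) a :
  (\forall y \near x, derivable f y u) -> derivable f x v ->
  derivable f x (a *: u + v) -> {for x, continuous ('D_u f)} ->
  'D_(a *: u + v) f x = a * 'D_u f x + 'D_v f x.
Proof.
move=> du dv dauv cu.
apply: cvg_lim => //.
have {}dv : h^-1 *: ((f \o shift x) (h *: v) - f x) @[h --> 0^'] --> 'D_v f x by exact: dv.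
have -> : (fun h => h^-1 *: ((f \o shift x) (h *: (a *: u + v)) - f x)) =
   (fun h => h^-1 *: (f ((h * a) *: u + (h *: v + x)) - f (h *: v + x))
           + h^-1 *: ((f \o shift x) (h *: v) - f x)).
  apply: funext => h /=; rewrite -scalerDr subrKA; congr (_ *: (f _ - _)).
  by rewrite scalerDr scalerA addrA.
apply: cvgD dv.
apply/cvgrPdist_le => eps eps0.
(* The summand 1 in M and in K below keeps them positive when a, u and v vanish. *)
pose M := `|a| + 1.
have M0 : 0 < M by rewrite /M; have := normr_ge0 a; lra.
have near_x : \forall y \near x, derivable f y u /\ `|'D_u f x - 'D_u f y| <= eps / M.
  near=> y; split; first by near: y.
  by near: y; move/cvgrPdist_le : cu; apply; exact: divr_gt0.
have /nbhs_normP[r /= r0 hr] := near_x.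
pose K := `|a| * `|u| + `|v| + 1.
have K0 : 0 < K.
  by rewrite /K; have := mulr_ge0 (normr_ge0 a) (normr_ge0 u); have := normr_ge0 v; lra.
near=> h.
have h0 : h != 0 by near: h; exact: nbhs_dnbhs_neq.
have hK : `|h| < r / K by near: h; apply: dnbhs0_lt; rewrite divr_gt0.
have close t : `|t| <= `|h * a| ->
    derivable f (t *: u + (h *: v + x)) u /\
    `|'D_u f x - 'D_u f (t *: u + (h *: v + x))| <= eps / M.
  move=> th; apply: hr; rewrite /ball_ /= addrA opprD addrCA subrr addr0 normrN.
  apply: le_lt_trans (ler_normD _ _) _; rewrite !normrZ.
  apply: (@le_lt_trans _ _ (`|h| * K)); last by rewrite -ltr_pdivlMr.
  apply: (@le_trans _ _ (`|h| * (`|a| * `|u| + `|v|))); last first.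
    by rewrite ler_wpM2l // /K lerDl.
  by rewrite mulrDr lerD2r mulrA -normrM ler_wpM2r.
have [|t tle ->] := @MVT_line f u (h *: v + x) (h * a); first by move=> t /close[].
have [_ ct] := close t tle.
rewrite [h^-1 *: _](_ : _ = a * 'D_u f (t *: u + (h *: v + x))); last first.
  by rewrite [LHS]mulrA mulrA mulVf // mul1r.
rewrite -mulrBr normrM.
apply: (@le_trans _ _ (`|a| * (eps / M))); first exact: ler_wpM2l.
rewrite mulrA ler_pdivrMr // mulrC ler_wpM2l ?(ltW eps0) // /M.
by rewrite lerDl.
Unshelve. all: by end_near. Qed.

End DirectionalDerivative.

(** * Smooth functions *)

Section SmoothFunctions.
Context {R : realType} {n : nat}.
Local Notation E := 'rV[R]_n.
Variable U : set E.
Hypothesis oU : open U.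
Implicit Types (k : nat).

(** Finite-order smoothness: closure under products and inverses, whose
    derivatives involve the functions themselves, goes by induction on the order. *)
Definition smooth_upto {W : normedModType R} k (f : E -> W) : Prop :=
  forall vs y, (size vs <= k)%N -> U y ->
    {for y, continuous (iterated_derive vs f)} /\
    (forall v, derivable (iterated_derive vs f) y v).

Lemma smooth_onP {W : normedModType R} (f : E -> W) :
  smooth_on U f <-> forall k, smooth_upto k f.
Proof.
by split=> [h k vs y _|h vs y]; [exact: h | exact: (h (size vs))].
Qed.

Lemma iterated_derive_rcons {W : normedModType R} vs v (f : E -> W) :
  iterated_derive (rcons vs v) f = iterated_derive vs ('D_v f).
Proof. by elim: vs => //= u vs ->. Qed.

Lemma smooth_on_derive {W : normedModType R} (f : E -> W) v :
  smooth_on U f -> smooth_on U ('D_v f).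
Proof. by move=> h vs y Uy; rewrite -iterated_derive_rcons; exact: h. Qed.

Lemma smooth_uptoS {W : normedModType R} k (f : E -> W) :
  smooth_upto k.+1 f <-> smooth_upto 0 f /\ forall v, smooth_upto k ('D_v f).
Proof.
split=> [h|[h0 h]].
  split=> [vs y|v vs y svs Uy].
    by rewrite leqn0 => /nilP -> Uy; exact: (h [::]).
  by rewrite -iterated_derive_rcons; apply: h; rewrite ?size_rcons.
move=> vs y; case/lastP: vs => [_ Uy|vs v]; first exact: (h0 [::]).
by rewrite size_rcons ltnS iterated_derive_rcons; exact: h.
Qed.

Lemma smooth_uptoW {W : normedModType R} k (f : E -> W) :
  smooth_upto k.+1 f -> smooth_upto k f.
Proof. by move=> h vs y svs; apply: h; apply: leqW. Qed.

Lemma smooth_upto_le {W : normedModType R} k (f : E -> W) :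
  smooth_upto k f -> smooth_upto 0 f.
Proof. by move=> h vs y; rewrite leqn0 => /nilP ->; exact: h. Qed.

Lemma smooth_upto_derivable {W : normedModType R} k (f : E -> W) y v :
  smooth_upto k f -> U y -> derivable f y v.
Proof. by move=> h Uy; exact: (h [::] y (leq0n k) Uy).2. Qed.

Lemma smooth_on_derivable {W : normedModType R} (f : E -> W) y v :
  smooth_on U f -> U y -> derivable f y v.
Proof. by move=> h Uy; exact: (h [::] y Uy).2. Qed.

Lemma near_open {W : Type} (f g : E -> W) y : (forall z, U z -> f z = g z) ->
  U y -> \forall z \near y, f z = g z.
Proof. by move=> fg Uy; apply: filterS fg _; exact: open_nbhs_nbhs. Qed.

Lemma derive_eq_on {W : normedModType R} (f g : E -> W) y v :
  (forall z, U z -> f z = g z) -> U y -> 'D_v f y = 'D_v g y.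
Proof. by move=> fg Uy; apply: near_eq_derive; exact: near_open. Qed.

Lemma smooth_upto_eq {W : normedModType R} k (f g : E -> W) :
  (forall z, U z -> f z = g z) -> smooth_upto k f -> smooth_upto k g.
Proof.
move=> fg h.
have E1 vs z : U z -> iterated_derive vs f z = iterated_derive vs g z.
  elim: vs z => [|v vs IH] z Uz /=; first exact: fg.
  exact: derive_eq_on.
move=> vs y svs Uy; have [c d] := h vs y svs Uy; split=> [|v].
  have e : {near nbhs y, iterated_derive vs f =1 iterated_derive vs g} := near_open (E1 vs) Uy.
  rewrite /prop_for /continuous_at -(E1 vs y Uy).
  exact: (cvg_trans (near_eq_cvg e) c).
by apply: near_eq_derivable (d v); exact: (near_open (E1 vs) Uy).
Qed.

Lemma smooth_on_eq {W : normedModType R} (f g : E -> W) :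
  (forall z, U z -> f z = g z) -> smooth_on U f -> smooth_on U g.
Proof. by move=> fg /smooth_onP h; apply/smooth_onP => k; apply: smooth_upto_eq fg _. Qed.

Lemma smooth_upto_cst k (a : R) : smooth_upto k (fun=> a : R^o).
Proof.
elim: k a => [|k IH] a.
  move=> vs y; rewrite leqn0 => /nilP -> _; split=> [|v]; first exact: cst_continuous.
  exact: derivable_cst.
apply/smooth_uptoS; split=> [|v]; first exact: smooth_upto_le (IH a).
by apply: smooth_upto_eq (IH 0) => z _; rewrite derive_cst.
Qed.

Lemma smooth_uptoD k (f g : E -> R^o) : smooth_upto k f -> smooth_upto k g ->
  smooth_upto k (fun y => f y + g y).
Proof.
elim: k f g => [|k IH] f g hf hg.
  move=> vs y; rewrite leqn0 => /nilP -> Uy.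
  have [cf df] := hf [::] y isT Uy; have [cg dg] := hg [::] y isT Uy.
  split=> [|v]; first exact: continuousD.
  exact: derivableD.
apply/smooth_uptoS; split=> [vs y|v].
  rewrite leqn0 => /nilP -> Uy.
  have [cf df] := hf [::] y isT Uy; have [cg dg] := hg [::] y isT Uy.
  split=> [|v]; first exact: continuousD.
  exact: derivableD.
have /smooth_uptoS[_ hf'] := hf; have /smooth_uptoS[_ hg'] := hg.
apply: smooth_upto_eq (IH _ _ (hf' v) (hg' v)) => z Uz.
by rewrite [RHS](@deriveD _ _ _ f g); [| exact: smooth_upto_derivable hf Uz
  | exact: smooth_upto_derivable hg Uz].
Qed.

Lemma smooth_uptoM k (f g : E -> R^o) : smooth_upto k f -> smooth_upto k g ->
  smooth_upto k (fun y => f y * g y).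
Proof.
have base k' (f' g' : E -> R^o) : smooth_upto k' f' -> smooth_upto k' g' ->
    smooth_upto 0 (fun y => f' y * g' y).
  move=> hf hg vs y; rewrite leqn0 => /nilP -> Uy.
  have [cf df] := hf [::] y isT Uy; have [cg dg] := hg [::] y isT Uy.
  split=> [|v]; first exact: (@continuousM _ _ f' g').
  exact: (@derivableM _ _ f' g').
elim: k f g => [|k IH] f g hf hg; first exact: (base 0%N).
apply/smooth_uptoS; split=> [|v]; first exact: base hf hg.
have /smooth_uptoS[_ hf'] := hf; have /smooth_uptoS[_ hg'] := hg.
apply: smooth_upto_eq (smooth_uptoD (IH _ _ (smooth_uptoW hf) (hg' v))
  (IH _ _ (smooth_uptoW hg) (hf' v))) => z Uz.
by rewrite [RHS](@deriveM _ _ f g); [| exact: smooth_upto_derivable hf Uz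
  | exact: smooth_upto_derivable hg Uz].
Qed.

Lemma smooth_uptoV k (f : E -> R^o) : (forall y, U y -> f y != 0) ->
  smooth_upto k f -> smooth_upto k (fun y => (f y)^-1).
Proof.
move=> f0.
have base k' : smooth_upto k' f -> smooth_upto 0 (fun y => (f y)^-1 : R^o).
  move=> hf vs y; rewrite leqn0 => /nilP -> Uy.
  have [cf df] := hf [::] y isT Uy.
  split=> [|v]; first by apply: (@continuousV _ _ f) => //; exact: f0.
  by apply: (@derivableV _ _ f) => //; exact: f0.
elim: k => [|k IH] hf; first exact: base hf.
apply/smooth_uptoS; split=> [|v]; first exact: base hf.
have /smooth_uptoS[_ hf'] := hf; have hi := IH (smooth_uptoW hf).
have := smooth_uptoM (smooth_uptoM (@smooth_upto_cst k (-1)) (smooth_uptoM hi hi)) (hf' v).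
apply: smooth_upto_eq => z Uz.
rewrite [RHS](@deriveV _ _ f) ?f0 //; last exact: smooth_upto_derivable hf Uz.
by rewrite mulN1r -invfM -expr2.
Qed.

Lemma smooth_on_cst (a : R) : smooth_on U (fun=> a : R^o).
Proof. by apply/smooth_onP => k; exact: smooth_upto_cst. Qed.

Lemma smooth_onD (f g : E -> R^o) : smooth_on U f -> smooth_on U g ->
  smooth_on U (fun y => f y + g y).
Proof. by move=> /smooth_onP hf /smooth_onP hg; apply/smooth_onP => k; exact: smooth_uptoD. Qed.

Lemma smooth_onM (f g : E -> R^o) : smooth_on U f -> smooth_on U g ->
  smooth_on U (fun y => f y * g y).
Proof. by move=> /smooth_onP hf /smooth_onP hg; apply/smooth_onP => k; exact: smooth_uptoM. Qed.

Lemma smooth_onV (f : E -> R^o) : (forall y, U y -> f y != 0) ->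
  smooth_on U f -> smooth_on U (fun y => (f y)^-1).
Proof. by move=> f0 /smooth_onP hf; apply/smooth_onP => k; exact: smooth_uptoV. Qed.

Lemma smooth_on_sum (I : Type) (r : seq I) (P : pred I) (f : I -> E -> R^o) :
  (forall i, P i -> smooth_on U (f i)) -> smooth_on U (fun y => \sum_(i <- r | P i) f i y).
Proof.
move=> hf; elim: r => [|i r IH].
  by apply: smooth_on_eq (smooth_on_cst 0) => z _; rewrite big_nil.
case: (boolP (P i)) => Pi.
  by apply: smooth_on_eq (smooth_onD (hf i Pi) IH) => z _; rewrite big_cons Pi.
by apply: smooth_on_eq IH => z _; rewrite big_cons (negbTE Pi).
Qed.

Lemma smooth_on_prod (I : Type) (r : seq I) (f : I -> E -> R^o) :
  (forall i, smooth_on U (f i)) -> smooth_on U (fun y => \prod_(i <- r) f i y).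
Proof.
move=> hf; elim: r => [|i r IH].
  by apply: smooth_on_eq (smooth_on_cst 1) => z _; rewrite big_nil.
by apply: smooth_on_eq (smooth_onM (hf i) IH) => z _; rewrite big_cons.
Qed.

Lemma smooth_on_mx m l (N : E -> 'M[R]_(m, l)) i j : smooth_on U N ->
  smooth_on U (fun y => N y i j : R^o).
Proof.
move=> /smooth_onP hN; apply/smooth_onP => k; move: (hN k) => {hN}.
have base k' (N' : E -> 'M[R]_(m, l)) : smooth_upto k' N' ->
    smooth_upto 0 (fun y => N' y i j : R^o).
  move=> hN vs y; rewrite leqn0 => /nilP -> Uy.
  have [c d] := hN [::] y isT Uy; split=> [|v].
    apply: (@continuous_comp _ _ R N' (fun A : 'M[R]_(m, l) => A i j)) => //.
    exact: matrix_normedtype.coord_continuous.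
  exact: (derivable_mxP _ _ _).1 (d v) i j.
elim: k N => [|k IH] N hN; first exact: base hN.
apply/smooth_uptoS; split=> [|v]; first exact: base hN.
have /smooth_uptoS[_ hN'] := hN.
apply: smooth_upto_eq (IH _ (hN' v)) => z Uz.
by rewrite derive_mx ?mxE //; exact: smooth_upto_derivable hN Uz.
Qed.

Lemma smooth_on_det m (N : E -> 'M[R]_m) :
  (forall i j, smooth_on U (fun y => N y i j : R^o)) ->
  smooth_on U (fun y => \det (N y) : R^o).
Proof.
move=> hN; apply: smooth_on_sum => s _; apply: smooth_onM; first exact: smooth_on_cst.
exact: smooth_on_prod.
Qed.

(** The inverse is the adjugate divided by the determinant. *)
Lemma smooth_on_invmx m (N : E -> 'M[R]_m) i j :
  (forall y, U y -> N y \in unitmx) ->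
  (forall i j, smooth_on U (fun y => N y i j : R^o)) ->
  smooth_on U (fun y => invmx (N y) i j : R^o).
Proof.
move=> uN hN.
have hc : smooth_on U (fun y => cofactor (N y) j i : R^o).
  apply: smooth_onM; first exact: smooth_on_cst.
  apply: smooth_on_det => i' j'.
  by apply: smooth_on_eq (hN (lift j i') (lift i j')) => z _; rewrite !mxE.
have hV : smooth_on U (fun y => (\det (N y))^-1 : R^o).
  apply: smooth_onV; last exact: smooth_on_det.
  by move=> y /uN; rewrite unitmxE unitfE.
by apply: smooth_on_eq (smooth_onM hV hc) => z Uz; rewrite /invmx uN // !mxE.
Qed.

Lemma smooth_on_derive_linear (f : E -> R^o) a u v y : smooth_on U f -> U y ->
  'D_(a *: u + v) f y = a * 'D_u f y + 'D_v f y.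
Proof.
move=> hf Uy; apply: derive_dir_linear; try exact: smooth_on_derivable Uy.
  near=> z; apply: smooth_on_derivable hf _.
  by near: z; exact: open_nbhs_nbhs.
exact: (smooth_on_derive u hf [::] Uy).1.
Unshelve. all: by end_near. Qed.

End SmoothFunctions.

(** * Bilinear forms on row vectors *)

Section BilinearAlgebra.
Context {R : realType} {n : nat}.
Local Notation T := 'rV[R]_n.
Implicit Types (G : 'M[R]_n) (u v : T) (xi : T -> R).
Local Notation "'e_ j" := (delta_mx 0 j : T) (at level 8, j at level 2).

Definition dual_vector xi := forall a u v, xi (a *: u + v) = a * xi u + xi v.

Lemma dual_vector_sum xi v : dual_vector xi -> xi v = \sum_j v 0 j * xi ('e_ j).
Proof.
move=> xl; rewrite {1}(row_sum_delta v).
have x0 : xi 0 = 0 by have := xl (-1) 0 0; rewrite scaler0 addr0 mulN1r addNr.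
elim: (index_enum _) => [|j r IH]; first by rewrite !big_nil.
by rewrite !big_cons xl IH.
Qed.

Lemma bilE G u v : bil G u v = \sum_j u 0 j * (G *m v^T) j 0.
Proof. by rewrite /bil -mulmxA !mxE; apply: eq_bigr => j _. Qed.

Lemma bil_linear_l G v : dual_vector (fun u => bil G u v).
Proof.
move=> a u u'; rewrite !bilE mulr_sumr -big_split; apply: eq_bigr => j _.
by rewrite !mxE /=; ring.
Qed.

Lemma bilT G u v : bil G u v = bil G^T v u.
Proof.
rewrite /bil; have -> : v *m G^T *m u^T = (u *m G *m v^T)^T.
  by rewrite !trmx_mul trmxK mulmxA.
by rewrite [RHS]mxE.
Qed.

Lemma bil_linear_r G u : dual_vector (bil G u).
Proof. by move=> a v v'; rewrite !(bilT G) bil_linear_l. Qed.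

Lemma bilDl G u v w : bil G (u + v) w = bil G u w + bil G v w.
Proof. by have := bil_linear_l G w 1 u v; rewrite scale1r mul1r. Qed.

Lemma bilDr G u v w : bil G w (u + v) = bil G w u + bil G w v.
Proof. by have := bil_linear_r G w 1 u v; rewrite scale1r mul1r. Qed.

Lemma bil0l G v : bil G 0 v = 0.
Proof. by rewrite /bil !mul0mx mxE. Qed.

Lemma bil0r G v : bil G v 0 = 0.
Proof. by rewrite bilT bil0l. Qed.

Lemma bilZl G a u v : bil G (a *: u) v = a * bil G u v.
Proof. by have := bil_linear_l G v a u 0; rewrite addr0 bil0l addr0. Qed.

Lemma bilZr G a u v : bil G u (a *: v) = a * bil G u v.
Proof. by rewrite bilT bilZl -bilT. Qed.

Lemma bilNl G u v : bil G (- u) v = - bil G u v.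
Proof. by rewrite -scaleN1r bilZl mulN1r. Qed.

Lemma bilNr G u v : bil G u (- v) = - bil G u v.
Proof. by rewrite bilT bilNl -bilT. Qed.

Lemma bilZm G a u v : bil (a *: G) u v = a * bil G u v.
Proof. by rewrite /bil -scalemxAr -scalemxAl mxE. Qed.

Lemma bil_sharp G xi v : G \in unitmx -> dual_vector xi -> bil G (sharp G xi) v = xi v.
Proof.
move=> uG xl; rewrite /bil /sharp -[_ *m _ *m G]mulmxA mulVmx // mulmx1 mxE.
by rewrite (dual_vector_sum v xl); apply: eq_bigr => j _; rewrite !mxE mulrC.
Qed.

Lemma bil_nondegenerate G u : G \in unitmx -> (forall v, bil G u v = 0) -> u = 0.
Proof.
move=> uG u0; rewrite -[u]mulmx1 -(mulmxV uG) mulmxA.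
have -> : u *m G = 0; last by rewrite mul0mx.
apply/rowP => k; rewrite [RHS]mxE -[RHS](u0 ('e_ k)) /bil [RHS]mxE (bigD1 k) //=.
rewrite big1 => [|l lk]; last by rewrite !mxE (negbTE lk) mulr0.
by rewrite [X in _ = _ * X + _]mxE [X in _ = _ * X + _]mxE !eqxx mulr1 addr0.
Qed.

End BilinearAlgebra.

(** * Calculus in a chart *)

(** Smoothness of a scalar function in a chart, as an inductive type so that
    it is never unfolded when two instances are compared. *)
Variant smooth_in {R : realType} {n : nat} {M : topologicalType}
    {A : smooth_manifold R n M} (i : chart A) (f : M -> R^o) : Prop :=
  SmoothIn of chart_smooth i setT f.

Section ChartCalculus.
Context {R : realType} {n : nat} {M : topologicalType}.
Variables (A : smooth_manifold R n M) (i : chart A).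
Local Notation T := 'rV[R]_n.
Local Notation "'e_ j" := (delta_mx 0 j : T) (at level 8, j at level 2).
Local Notation dom := (chart_dom i).
Local Notation img := (chart_coord i @` (setT `&` dom)).
Local Notation smooth f := (smooth_in i f).
Implicit Types (f : M -> R^o) (x : M) (v : T).

Lemma img_open : open img.
Proof. by rewrite setTI; exact: coord_open. Qed.

Lemma img_coord x : dom x -> img (chart_coord i x).
Proof. by move=> dx; exists x. Qed.

Lemma param_dom y : img y -> dom (param i y).
Proof. by case=> x [_ dx] <-; rewrite chart_coordK. Qed.

Lemma dchart_eq {W : normedModType R} (f f' : M -> W) v x :
  (forall y, dom y -> f y = f' y) -> dom x -> dchart i v f x = dchart i v f' x.
Proof.
move=> ff dx; apply: (derive_eq_on img_open) (img_coord dx) => y /param_dom /ff.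
by [].
Qed.

Lemma chart_smooth_eq f f' : (forall y, dom y -> f y = f' y) -> smooth f -> smooth f'.
Proof.
move=> ff [sf]; apply: SmoothIn; apply: (smooth_on_eq img_open) sf.
by move=> y /param_dom /ff.
Qed.

Lemma chart_smooth_cst (a : R) : smooth (fun=> a : R^o).
Proof. exact/SmoothIn/(smooth_on_cst img_open a). Qed.

Lemma chart_smoothD f f' : smooth f -> smooth f' -> smooth (fun y => f y + f' y : R^o).
Proof. by case=> sf [sf']; exact/SmoothIn/(smooth_onD img_open). Qed.

Lemma chart_smoothM f f' : smooth f -> smooth f' -> smooth (fun y => f y * f' y : R^o).
Proof. by case=> sf [sf']; exact/SmoothIn/(smooth_onM img_open). Qed.

Lemma chart_smooth_sum (I : Type) (r : seq I) (f : I -> M -> R^o) :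
  (forall j, smooth (f j)) -> smooth (fun y => \sum_(j <- r) f j y : R^o).
Proof.
move=> sf; apply: SmoothIn; apply: (smooth_on_sum img_open) => j _.
by case: (sf j).
Qed.

Lemma chart_smooth_mx m l (N : M -> 'M[R]_(m, l)) j k :
  chart_smooth i setT N -> smooth (fun y => N y j k : R^o).
Proof. by move=> sN; exact/SmoothIn/(smooth_on_mx img_open). Qed.

Lemma chart_smooth_invmx m (N : M -> 'M[R]_m) j k :
  (forall y, dom y -> N y \in unitmx) ->
  (forall j k, smooth (fun y => N y j k : R^o)) ->
  smooth (fun y => invmx (N y) j k : R^o).
Proof.
move=> uN sN; apply: SmoothIn.
apply: (smooth_on_invmx img_open (N := N \o param i)) => [y /param_dom /uN //|j' k'].
by case: (sN j' k').
Qed.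

Lemma dchart_derivable f v x : smooth f -> dom x ->
  derivable (f \o param i) (chart_coord i x) v.
Proof. by case=> sf dx; apply: smooth_on_derivable sf _; exact: img_coord. Qed.

Lemma dchart_cst {W : normedModType R} (a : W) v x : dchart i v (fun=> a) x = 0.
Proof. exact: derive_cst. Qed.

Lemma dchartD f f' v x : smooth f -> smooth f' -> dom x ->
  dchart i v (fun y => f y + f' y : R^o) x = dchart i v f x + dchart i v f' x.
Proof. by move=> sf sf' dx; apply: deriveD; exact: dchart_derivable. Qed.

Lemma dchartM f f' v x : smooth f -> smooth f' -> dom x ->
  dchart i v (fun y => f y * f' y : R^o) x
  = f x * dchart i v f' x + f' x * dchart i v f x.
Proof.
move=> sf sf' dx.
have := deriveM (dchart_derivable (v := v) sf dx) (dchart_derivable (v := v) sf' dx).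
by rewrite /= chart_coordK.
Qed.

Lemma dchartZ f (a : R) v x : smooth f -> dom x ->
  dchart i v (fun y => a * f y : R^o) x = a * dchart i v f x.
Proof.
move=> sf dx; rewrite dchartM //; last exact: chart_smooth_cst.
by rewrite dchart_cst mulr0 addr0.
Qed.

Lemma dchart_sum (I : Type) (r : seq I) (f : I -> M -> R^o) v x :
  (forall j, smooth (f j)) -> dom x ->
  dchart i v (fun y => \sum_(j <- r) f j y : R^o) x = \sum_(j <- r) dchart i v (f j) x.
Proof.
move=> sf dx; elim: r => [|j r IH].
  rewrite big_nil -[RHS](dchart_cst (0 : R^o) v x).
  by apply: dchart_eq => // y _; rewrite big_nil.
rewrite big_cons -IH -dchartD //; last exact: chart_smooth_sum.
by apply: dchart_eq => // y _; rewrite big_cons.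
Qed.

Lemma dchart_linear f a u v x : smooth f -> dom x ->
  dchart i (a *: u + v) f x = a * dchart i u f x + dchart i v f x.
Proof.
by case=> sf dx; apply: (smooth_on_derive_linear img_open) sf _; exact: img_coord.
Qed.

Lemma dchart_row (Y : M -> T) v x k : (forall j, smooth (fun y => Y y 0 j : R^o)) ->
  dom x -> dchart i v Y x 0 k = dchart i v (fun y => Y y 0 k : R^o) x.
Proof.
move=> sY dx; rewrite {1}/dchart derive_mx ?mxE //.
by apply/derivable_mxP => j l; rewrite ord1; exact: (dchart_derivable (sY l) dx).
Qed.

End ChartCalculus.

(** * The tractor space *)

Section TractorAlgebra.
Context {R : realType} {n : nat}.
Local Notation T := 'rV[R]_n.
Local Notation TV := (@tractor R n).
Local Notation "'e_ j" := (delta_mx 0 j : T) (at level 8, j at level 2).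
Variable G : 'M[R]_n.
Hypothesis Gsym : G^T = G.
Hypothesis Gunit : G \in unitmx.

Lemma bil_sym u v : bil G u v = bil G v u.
Proof. by rewrite bilT Gsym. Qed.

Lemma tmetric_linear (t : TV) k u v :
  tmetric G (k *: u + v) t = k * tmetric G u t + tmetric G v t.
Proof.
rewrite /tmetric /= bil_linear_l.
rewrite -[k *: u.1.1]/(k * u.1.1) -[k *: u.2]/(k * u.2); ring.
Qed.

Lemma tmetric_sym (u v : TV) : tmetric G u v = tmetric G v u.
Proof. by rewrite /tmetric bil_sym; ring. Qed.

Lemma tractor_split (t : TV) :
  t = t.1.1 *: s_minus + (t.2 *: s_plus + tangent_tractor t.1.2).
Proof.
case: t => [[a Y] b] /=; congr (_, _, _) => /=; last 1 first.
- by rewrite [a *: _]mulr0 [b *: _]mulr1 addr0 add0r.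
- by rewrite [a *: _]mulr1 [b *: _]mulr0 !addr0.
- by rewrite !scaler0 !add0r.
Qed.

Lemma tangent_tractor_linear a (u v : T) :
  tangent_tractor (a *: u + v) = a *: tangent_tractor u + tangent_tractor v :> TV.
Proof. by congr (_, _, _) => /=; rewrite ?addr0 // [a *: _]mulr0. Qed.

Lemma tractor_dual_split (F : TV -> R) (t : TV) :
  (forall a u v, F (a *: u + v) = a * F u + F v) ->
  F t = t.1.1 * F s_minus + (t.2 * F s_plus + \sum_j t.1.2 0 j * F (tangent_tractor ('e_ j))).
Proof.
move=> Fl; rewrite {1}[t]tractor_split !Fl; congr (_ + (_ + _)).
apply: (@dual_vector_sum _ _ (fun v => F (tangent_tractor v))) => a u v.
by rewrite tangent_tractor_linear Fl.
Qed.

(** The components are the pairings of the image with s_plus, with the tangent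
    vectors and with s_minus. *)
Definition tractor_endo (a : form TV) (t : TV) : TV :=
  (a [:: t; s_plus] : R^o, sharp G (fun v => a [:: t; tangent_tractor v]),
   a [:: t; s_minus] : R^o).

Lemma tmetric_tractor_endo a t u : alternating a ->
  tmetric G (tractor_endo a t) u = a [:: t; u].
Proof.
move=> aa.
have al c v w : a [:: t; c *: v + w] = c * a [:: t; v] + a [:: t; w].
  exact: (proj1 aa [:: t] [::]).
rewrite {2}[u]tractor_split !al /tmetric /= bil_sharp //; first by ring.
by move=> c v w; rewrite tangent_tractor_linear al.
Qed.

Lemma tmetric_nondegenerate (t : TV) : (forall u, tmetric G t u = 0) -> t = 0.
Proof.
move=> t0; have tp := t0 s_plus; have tm := t0 s_minus.
have tY : t.1.2 = 0.
  apply: (bil_nondegenerate Gunit) => v; have := t0 (tangent_tractor v).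
  by rewrite /tmetric /= mulr0 mul0r !add0r.
move: tp tm tY; rewrite /tmetric /= !bil0r !addr0 !mulr1 !mulr0 !mul0r !mul1r.
by rewrite addr0 add0r; case: t {t0} => [[a Y] b] /= -> -> ->.
Qed.

End TractorAlgebra.

(** * Levi-Civita and tractor connections in a chart *)

Section ChartGeometry.
Context {R : realType} {n : nat} {M : topologicalType}.
Variables (A : smooth_manifold R n M) (i : chart A) (g : metric_field A).
Local Notation T := 'rV[R]_n.
Local Notation TV := (@tractor R n).
Local Notation "'e_ j" := (delta_mx 0 j : T) (at level 8, j at level 2).
Local Notation dom := (chart_dom i).
Local Notation smooth f := (smooth_in i f).
Hypothesis gsym : forall x, dom x -> (g i x)^T = g i x.
Hypothesis gunit : forall x, dom x -> g i x \in unitmx.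
Hypothesis gsmooth : forall j k, smooth (fun y => g i y j k : R^o).
Implicit Types (x : M) (X u v : T).

Local Notation dg x a b c := (dchart i a (fun y => bil (g i y) b c : R^o) x).

Lemma smooth_bil u v : smooth (fun y => bil (g i y) u v : R^o).
Proof.
apply: (@chart_smooth_eq _ _ _ _ _
  (fun y => \sum_j u 0 j * \sum_k g i y j k * v 0 k : R^o)) => [y _|].
  rewrite bilE; apply: eq_bigr => j _; rewrite !mxE; congr (_ * _).
  by apply: eq_bigr => k _; rewrite !mxE.
apply: chart_smooth_sum => j; apply: chart_smoothM; first exact: chart_smooth_cst.
apply: chart_smooth_sum => k; apply: chart_smoothM; last exact: chart_smooth_cst.
exact: gsmooth.
Qed.

Lemma dmetric_sym x a b c : dom x -> dg x a b c = dg x a c b.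
Proof. by move=> dx; apply: dchart_eq => // y dy; rewrite bil_sym ?gsym. Qed.

Lemma dmetric_linear2 x a c : dom x -> dual_vector (fun b => dg x a b c).
Proof.
move=> dx k u v.
rewrite -dchartZ //; last exact: smooth_bil.
rewrite -dchartD //; [|apply: chart_smoothM|]; try exact: smooth_bil;
  last exact: chart_smooth_cst.
by apply: dchart_eq => // y dy; rewrite bil_linear_l.
Qed.

Lemma dmetric_linear3 x a b : dom x -> dual_vector (fun c => dg x a b c).
Proof. by move=> dx k u v; rewrite !(dmetric_sym a b) // dmetric_linear2. Qed.

Lemma dmetric_linear1 x b c : dom x -> dual_vector (fun a => dg x a b c).
Proof. by move=> dx k u v; rewrite dchart_linear //; exact: smooth_bil. Qed.

(** The Koszul formula defines the functional of z; it is the pairing with a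
    vector because the derivative is linear in the direction z. *)
Lemma bil_christoffel x u v z : dom x ->
  bil (g i x) (christoffel g i x u v) z = 2^-1 * (dg x u v z + dg x v u z - dg x z u v).
Proof.
move=> dx; rewrite bil_sharp ?gunit // => k a b.
rewrite !dmetric_linear3 // dmetric_linear1 //.
move: (dg x u v a) (dg x u v b) (dg x v u a) (dg x v u b) (dg x a u v) (dg x b u v).
by move=> *; ring.
Qed.

Lemma christoffelC x u v : dom x -> christoffel g i x u v = christoffel g i x v u.
Proof.
move=> dx; rewrite /christoffel; congr sharp; apply: funext => z.
by rewrite (dmetric_sym z u v dx) [dg x u v z + _]addrC.
Qed.

(** In the two Koszul formulas all terms cancel but the derivative of g along X. *)
Lemma christoffel_metric x X u v : dom x ->
  dg x X u v = bil (g i x) (christoffel g i x X u) v + bil (g i x) u (christoffel g i x X v).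
Proof.
move=> dx; rewrite (bil_sym (gsym dx) u) !bil_christoffel //.
by rewrite (dmetric_sym X v u) //; field.
Qed.

Lemma dchart_bil x X (Y : M -> T) u : dom x ->
  (forall j, smooth (fun y => Y y 0 j : R^o)) ->
  dchart i X (fun y => bil (g i y) (Y y) u : R^o) x
  = dg x X (Y x) u + bil (g i x) (dchart i X Y x) u.
Proof.
move=> dx sY.
rewrite (@dchart_eq _ _ _ _ _ _ _
  (fun y => \sum_j Y y 0 j * bil (g i y) ('e_ j) u : R^o)) //; last first.
  by move=> y _; rewrite (dual_vector_sum (Y y) (bil_linear_l (g i y) u)).
rewrite dchart_sum // => [|j]; last by apply: chart_smoothM; [exact: sY|exact: smooth_bil].
rewrite (dual_vector_sum (Y x) (dmetric_linear2 X u dx)).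
rewrite (dual_vector_sum (dchart i X Y x) (bil_linear_l (g i x) u)) -big_split /=.
apply: eq_bigr => j _; rewrite dchartM //; last exact: smooth_bil.
by rewrite dchart_row //; ring.
Qed.

Definition smooth_tractor (t : M -> TV) : Prop :=
  [/\ smooth (fun y => (t y).1.1 : R^o),
      forall j, smooth (fun y => (t y).1.2 0 j : R^o) &
      smooth (fun y => (t y).2 : R^o)].

Definition dtractor X (t : M -> TV) x : TV :=
  (dchart i X (fun y => (t y).1.1) x, dchart i X (fun y => (t y).1.2) x,
   dchart i X (fun y => (t y).2) x).

(** The connection is a derivative of components plus a term of order zero. *)
Lemma tractor_nabla_const X (t : M -> TV) x :
  tractor_nabla g i X t x = dtractor X t x + tractor_nabla g i X (fun=> t x) x.
Proof.
congr (_, _, _); rewrite /= /nabla !dchart_cst ?add0r //.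
by rewrite -!addrA.
Qed.

(** Apart from the metric compatibility of the Levi-Civita connection, every term
    of the tractor connection occurs twice with opposite signs. *)
Lemma tractor_nabla_metric X (t : M -> TV) (u : TV) x : dom x -> smooth_tractor t ->
  dchart i X (fun y => tmetric (g i y) (t y) u : R^o) x
  = tmetric (g i x) (tractor_nabla g i X t x) u
    + tmetric (g i x) (t x) (tractor_nabla g i X (fun=> u) x).
Proof.
move=> dx [sa sY sb]; have cst (a : R) : smooth (fun=> a : R^o) by exact: chart_smooth_cst.
have sB : smooth (fun y => bil (g i y) (t y).1.2 u.1.2 : R^o).
  apply: (@chart_smooth_eq _ _ _ _ _
    (fun y => \sum_j (t y).1.2 0 j * bil (g i y) ('e_ j) u.1.2 : R^o)).
    by move=> y _; rewrite -(dual_vector_sum (t y).1.2 (bil_linear_l (g i y) u.1.2)).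
  by apply: chart_smooth_sum => j; apply: chart_smoothM; [exact: sY|exact: smooth_bil].
have s1 : smooth (fun y => (t y).1.1 * u.2 : R^o) by exact: chart_smoothM.
have s2 : smooth (fun y => u.1.1 * (t y).2 : R^o) by exact: chart_smoothM.
rewrite /tmetric dchartD //; last exact: chart_smoothD.
rewrite dchartD // !dchartM // !dchart_cst dchart_bil // christoffel_metric //.
rewrite /tractor_nabla /nabla /= !dchart_cst.
rewrite !(bilDl, bilDr, bilNl, bilNr, bilZl, bilZr).
rewrite bil_sharp ?gunit //; last exact: bil_linear_r.
rewrite (bil_sym (gsym dx) _ (sharp _ _)) bil_sharp ?gunit //; last exact: bil_linear_r.
by rewrite (bil_sym (gsym dx) (t x).1.2 X) bil0r; ring.
Qed.


(** * Parallel tractor forms *)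

Definition chart_parallel (w : M -> form TV) : Prop :=
  [/\ forall x, dom x -> alternating (w x),
      forall s, smooth (fun y => w y s) &
      forall x, dom x -> forall X s, tractor_form_nabla g i X w x s = 0].

(** Expanding one entry in the frame s_minus, tangent basis, s_plus reduces
    derivatives of a form with a varying entry to those of scalar functions. *)
Lemma form_entry_split (w : form TV) (s : seq TV) m t : alternating w ->
  (m < size s)%N ->
  w (set_nth 0 s m t) = t.1.1 * w (set_nth 0 s m s_minus)
    + (t.2 * w (set_nth 0 s m s_plus)
       + \sum_j t.1.2 0 j * w (set_nth 0 s m (tangent_tractor ('e_ j)))).
Proof.
move=> aw lt; apply: (tractor_dual_split (F := fun t => w (set_nth 0 s m t))).
exact: alternating_set_nth.
Qed.

Lemma smooth_form_entry (w : M -> form TV) (s : seq TV) m t :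
  (forall x, dom x -> alternating (w x)) -> (forall s, smooth (fun y => w y s)) ->
  (m < size s)%N -> smooth_tractor t -> smooth (fun y => w y (set_nth 0 s m (t y))).
Proof.
move=> aw sw lt [sa sY sb].
apply: (@chart_smooth_eq _ _ _ _ _ (fun y =>
   (t y).1.1 * w y (set_nth 0 s m s_minus)
    + ((t y).2 * w y (set_nth 0 s m s_plus)
       + \sum_j (t y).1.2 0 j * w y (set_nth 0 s m (tangent_tractor ('e_ j)))) : R^o)).
  by move=> y dy; rewrite -form_entry_split //; exact: aw.
apply: chart_smoothD; first exact: chart_smoothM.
apply: chart_smoothD; first exact: chart_smoothM.
by apply: chart_smooth_sum => j; exact: chart_smoothM.
Qed.

Lemma dchart_form_entry (w : M -> form TV) (s : seq TV) m t X x :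
  (forall x, dom x -> alternating (w x)) -> (forall s, smooth (fun y => w y s)) ->
  (m < size s)%N -> smooth_tractor t -> dom x ->
  dchart i X (fun y => w y (set_nth 0 s m (t y))) x
  = dchart i X (fun y => w y (set_nth 0 s m (t x))) x
    + w x (set_nth 0 s m (dtractor X t x)).
Proof.
move=> aw sw lt [sa sY sb] dx.
have E (t' : M -> TV) : smooth_tractor t' ->
    dchart i X (fun y => w y (set_nth 0 s m (t' y))) x =
    ((t' x).1.1 * dchart i X (fun y => w y (set_nth 0 s m s_minus)) x
     + ((t' x).2 * dchart i X (fun y => w y (set_nth 0 s m s_plus)) x
       + \sum_j (t' x).1.2 0 j
           * dchart i X (fun y => w y (set_nth 0 s m (tangent_tractor ('e_ j)))) x))
    + w x (set_nth 0 s m (dtractor X t' x)).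
  move=> [sa' sY' sb'].
  rewrite (@dchart_eq _ _ _ _ _ _ _ (fun y =>
     (t' y).1.1 * w y (set_nth 0 s m s_minus)
      + ((t' y).2 * w y (set_nth 0 s m s_plus)
         + \sum_j (t' y).1.2 0 j * w y (set_nth 0 s m (tangent_tractor ('e_ j)))) : R^o)) //;
    last first.
    by move=> y dy; rewrite -form_entry_split //; exact: aw.
  have sS : smooth (fun y =>
      \sum_j (t' y).1.2 0 j * w y (set_nth 0 s m (tangent_tractor ('e_ j))) : R^o).
    by apply: chart_smooth_sum => j; exact: chart_smoothM.
  have s1 : smooth (fun y => (t' y).1.1 * w y (set_nth 0 s m s_minus) : R^o).
    exact: chart_smoothM.
  have s2 : smooth (fun y => (t' y).2 * w y (set_nth 0 s m s_plus) : R^o).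
    exact: chart_smoothM.
  rewrite dchartD //; last exact: chart_smoothD.
  rewrite dchartD // !dchartM // dchart_sum //; last first.
    by move=> j; exact: chart_smoothM.
  rewrite (form_entry_split (dtractor X t' x) (aw x dx) lt) /=.
  rewrite [\sum_j dchart _ _ _ _](_ : _ =
    \sum_j (t' x).1.2 0 j
           * dchart i X (fun y => w y (set_nth 0 s m (tangent_tractor ('e_ j)))) x
    + \sum_j dchart i X (fun y => (t' y).1.2) x 0 j
           * w x (set_nth 0 s m (tangent_tractor ('e_ j)))); first by ring.
  rewrite -big_split /=; apply: eq_bigr => j _.
  by rewrite dchartM // dchart_row //; ring.
rewrite (E t) // (E (fun=> t x)) /=; last first.
  by split=> [|j|]; exact: chart_smooth_cst.
have -> : dtractor X (fun=> t x) x = 0 by rewrite /dtractor !dchart_cst.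
by rewrite alternating_set_nth0 ?addr0 //; exact: aw.
Qed.

Lemma dchart_parallel w X x s : chart_parallel w -> dom x ->
  dchart i X (fun y => w y s) x
  = \sum_(j < size s) w x (set_nth 0 s j (tractor_nabla g i X (fun=> s`_j) x)).
Proof. by move=> [_ _ pw] dx; apply/eqP; rewrite -subr_eq0; apply/eqP; exact: pw. Qed.

(** The varying entry contributes its full covariant derivative: the derivative of
    its components adds to the connection term at its fixed value. *)
Lemma dchart_parallel_entry w X x (s : seq TV) (m : 'I_(size s)) t :
  chart_parallel w -> dom x -> smooth_tractor t ->
  dchart i X (fun y => w y (set_nth 0 s m (t y))) x
  = w x (set_nth 0 s m (tractor_nabla g i X t x))
    + \sum_(j < size s | j != m)
        w x (set_nth 0 (set_nth 0 s m (t x)) j (tractor_nabla g i X (fun=> s`_j) x)).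
Proof.
move=> pw dx st; have [aw sw _] := pw.
rewrite dchart_form_entry // dchart_parallel //.
have -> : size (set_nth 0 s m (t x)) = size s by rewrite size_set_nth; apply/maxn_idPr.
rewrite (bigD1 m) //= nth_set_nth /= eqxx set_set_nth eqxx.
rewrite [X in _ = w x (set_nth 0 s m X) + _]tractor_nabla_const.
rewrite -[X in _ = w x (set_nth 0 s m (X + _)) + _]scale1r.
rewrite (alternating_set_nth (aw x dx)) // mul1r.
rewrite [LHS]addrC !addrA; congr (_ + _).
apply: eq_bigr => j jm; rewrite nth_set_nth /= ifN //.
Qed.

Section TwoForm.
Variable a : M -> form TV.
Hypothesis pa : chart_parallel a.
Local Notation endo y := (tractor_endo (g i y) (a y)).

Lemma smooth_tractor_endo t : smooth_tractor (fun y => endo y t).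
Proof.
have [aa sa _] := pa; split=> [|j|] /=; try exact: sa.
apply: (@chart_smooth_eq _ _ _ _ _ (fun y =>
  \sum_k a y [:: t; tangent_tractor ('e_ k)] * invmx (g i y) k j : R^o)).
  by move=> y _; rewrite /sharp mxE; apply: eq_bigr => k _; rewrite mxE.
apply: chart_smooth_sum => k; apply: chart_smoothM; first exact: sa.
apply: chart_smooth_invmx => [y dy|j' k']; first exact: gunit.
exact: gsmooth.
Qed.

(** Pairing with u, the derivative of the pairing of E t with u is that of
    a [:: t; u], and both the metric and a are parallel; the metric being
    nondegenerate, the two sides agree. *)
Lemma tractor_nabla_endo X t x : dom x ->
  tractor_nabla g i X (fun y => endo y t) x = endo x (tractor_nabla g i X (fun=> t) x).
Proof.
move=> dx; have [aa _ _] := pa.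
apply/eqP; rewrite -subr_eq0 addrC -scaleN1r; apply/eqP.
apply: (tmetric_nondegenerate (gunit dx)) => u.
rewrite tmetric_linear tmetric_tractor_endo ?gunit //; last exact: aa.
have := tractor_nabla_metric X u dx (smooth_tractor_endo t).
rewrite tmetric_tractor_endo ?gunit //; last exact: aa.
rewrite (@dchart_eq _ _ _ _ _ _ _ (fun y => a y [:: t; u])) //; last first.
  by move=> y dy; rewrite tmetric_tractor_endo ?gunit //; exact: aa.
by rewrite dchart_parallel // !big_ord_recl big_ord0 /= addr0 => h; lra.
Qed.

End TwoForm.

(** The Leibniz rule differentiates the entry holding E s_m, which gives E applied
    to the derivative of s_m because E is parallel, or another entry; these are the
    terms of the derivation evaluated on the differentiated entries. *)
Lemma derivation_parallel a b X x s : chart_parallel a -> chart_parallel b -> dom x ->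
  tractor_form_nabla g i X (fun y => derivation (tractor_endo (g i y) (a y)) (b y)) x s = 0.
Proof.
move=> pa pb dx; rewrite /tractor_form_nabla /derivation.
have [ab sb _] := pb.
rewrite dchart_sum //; last first.
  by move=> m; apply: smooth_form_entry => //; exact: smooth_tractor_endo.
under eq_bigr => m _ do rewrite (dchart_parallel_entry _ m pb dx (smooth_tractor_endo pa _))
  tractor_nabla_endo //.
apply/eqP; rewrite subr_eq0 big_split /= (exchange_big_dep xpredT) //= -big_split /=.
apply/eqP; apply: eq_bigr => j _.
have -> : size (set_nth 0 s j (tractor_nabla g i X (fun=> s`_j) x)) = size s.
  by rewrite size_set_nth; apply/maxn_idPr.
rewrite [RHS](bigD1 j) //= nth_set_nth /= eqxx set_set_nth eqxx; congr (_ + _).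
apply: eq_big => [m|m jm]; first by rewrite eq_sym.
have mj : (m == j :> nat) = false by apply/negbTE; rewrite eq_sym.
by rewrite nth_set_nth /= mj; congr (b x _); rewrite [RHS]set_set_nth eq_sym mj.
Qed.

(** * The Lie derivative along the vector field of a parallel 2-form *)

Lemma christoffel0 x X : dom x -> christoffel g i x X 0 = 0.
Proof.
move=> dx; apply: (bil_nondegenerate (gunit dx)) => z; rewrite bil_christoffel //.
have z2 b c : dg x b 0 c = 0.
  rewrite -[RHS](dchart_cst i (0 : R^o) b x); apply: dchart_eq => // y _.
  by rewrite bil0l.
by rewrite z2 (dmetric_sym z X 0 dx) z2 /dchart derive0 !addr0 subr0 mulr0.
Qed.

Lemma tractor_nabla_minus x X : dom x ->
  tractor_nabla g i X (fun=> s_minus) x = tangent_tractor X.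
Proof.
move=> dx; rewrite /tractor_nabla /nabla !dchart_cst !bil0r /= christoffel0 //.
by rewrite scale1r scale0r !subr0 !add0r.
Qed.

Lemma tractor_nabla_tangent x X v :
  tractor_nabla g i X (fun=> tangent_tractor v) x
  = (bil (Kg g i x) X v : R^o, christoffel g i x X v, - bil (g i x) X v : R^o).
Proof.
by rewrite /tractor_nabla /nabla !dchart_cst /= !scale0r !addr0 subr0 !add0r.
Qed.

Section LieDerivative.
Variable a : M -> form TV.
Hypothesis pa : chart_parallel a.
Local Notation endo y := (tractor_endo (g i y) (a y)).
Local Notation f y := (a y [:: s_plus; s_minus]).

Variable V : vector_field A.
Hypothesis VE : forall y, V i y = (endo y s_minus).1.2.

(** V is the tangent part of E s_minus, the derivative of s_minus along X is the
    tangent vector X, and the s_minus part of E s_minus is - f, which contributes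
    - f X to the derivative. *)
Lemma nabla_vector_field x X : dom x ->
  nabla g i X (V i) x = (endo x (tangent_tractor X)).1.2 + f x *: X.
Proof.
move=> dx; have := tractor_nabla_endo pa X s_minus dx.
rewrite tractor_nabla_minus // => /(congr1 (fun t => t.1.2)) /= <-.
have [aa _ _] := pa.
have a0 : a x [:: s_minus; s_minus] = 0 by exact: (proj2 (aa x dx) [::] [::] [::]).
rewrite a0 scale0r subr0 (interiorC s_minus s_plus); last exact: aa.
rewrite scaleNr addrNK; congr (nabla g i X _ x).
by apply: funext => y; rewrite VE.
Qed.

Lemma dchart_vector_field x X : dom x ->
  dchart i X (V i) x
  = (endo x (tangent_tractor X)).1.2 + f x *: X - christoffel g i x (V i x) X.
Proof.
move=> dx; rewrite -nabla_vector_field // /nabla christoffelC //.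
by rewrite addrK.
Qed.

Lemma bil_endo_tangent x u v : dom x ->
  bil (g i x) (endo x (tangent_tractor u)).1.2 v
  = a x [:: tangent_tractor u; tangent_tractor v].
Proof.
move=> dx; have [aa _ _] := pa; rewrite bil_sharp ?gunit // => k w w'.
rewrite tangent_tractor_linear; exact: (proj1 (aa x dx) [:: _] [::]).
Qed.

Lemma lie_bracket_const x u : lie_bracket i (V i) (fun=> u) x = - dchart i u (V i) x.
Proof. by rewrite /lie_bracket dchart_cst sub0r. Qed.

(** The skew part of the covariant derivative of V does not change the metric;
    the remaining part is f times the identity. *)
Lemma lie_metric_vector_field x u v : dom x ->
  lie_metric V g i x u v = 2 * f x * bil (g i x) u v.
Proof.
move=> dx; rewrite /lie_metric !lie_bracket_const !dchart_vector_field //.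
rewrite christoffel_metric // !(bilNl, bilNr, bilDl, bilDr, bilZl, bilZr).
rewrite (bil_sym (gsym dx) u (endo x (tangent_tractor v)).1.2).
rewrite !bil_endo_tangent //.
rewrite (interiorC (tangent_tractor v)); last by have [aa _ _] := pa; exact: aa.
by ring.
Qed.

Lemma set_nth_tangent (s : seq T) j v :
  map (@tangent_tractor R n) (set_nth 0 s j v)
  = set_nth 0 (map (@tangent_tractor R n) s) j (tangent_tractor v).
Proof.
elim: s j => [|u s IH] [|j] //=; last by rewrite IH.
by congr (_ :: _); elim: j => //= j ->.
Qed.

Lemma form_repeat_minus (w : form TV) s j : alternating w -> (j < size s)%N ->
  w (s_minus :: set_nth 0 s j s_minus) = 0.
Proof. by move=> aw lt; rewrite set_nth_cat //; exact: (proj2 aw [::]). Qed.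

Variable b : M -> form TV.
Hypothesis pb : chart_parallel b.

(** On each tangent entry, moving by the tractor connection along V and by the
    Lie bracket with V combine to E plus f times the identity, up to a multiple of
    s_minus that the form does not see next to its entry s_minus; that first entry
    itself contributes - f. *)
Lemma lie_form_plus (w : form_field A) x (s : seq T) :
  (forall y, w i y = plus_part (b y)) -> dom x ->
  lie_form V w i x s - (size s).+1%:R * f x * w i x s
  = plus_part (derivation (endo x) (b x)) s.
Proof.
move=> wE dx; have [ab sb _] := pb; have [aa _ _] := pa.
have abx := ab x dx; have aax := aa x dx.
rewrite /lie_form (_ : (fun y => w i y s) = fun y => plus_part (b y) s); last first.
  by apply: funext => y; rewrite wE.
rewrite wE /plus_part; set S := map _ s.
have sS : size S = size s by rewrite size_map.
rewrite dchart_parallel // /derivation /= !big_ord_recl /= tractor_nabla_minus //.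
have endo_minus : endo x s_minus = (- f x) *: s_minus + tangent_tractor (V i x).
  rewrite VE /tractor_endo /=; congr (_, _, _) => /=.
  - by rewrite addr0 [_ *: _]mulr1 (interiorC s_minus s_plus).
  - by rewrite scaler0 add0r.
  - by rewrite [_ *: _]mulr0 addr0; exact: (proj2 aax [::] [::] [::]).
rewrite endo_minus (proj1 abx [::] S) /=.
rewrite -!addrA [RHS]addrCA; congr (_ + _).
rewrite [X in _ = _ + X](_ : _ =
   \sum_(j < size s) b x (s_minus :: set_nth 0 S j (endo x S`_j))); last first.
  by rewrite -sS; apply: eq_bigr => j _.
rewrite [X in X + _ = _](_ : _ = \sum_(j < size s)
   b x (s_minus :: set_nth 0 S j (tractor_nabla g i (V i x) (fun=> S`_j) x))); last first.
  by rewrite -sS; apply: eq_bigr => j _.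
rewrite addrA -sumrB.
rewrite (eq_bigr (fun j : 'I_(size s) => b x (s_minus :: set_nth 0 S j (endo x S`_j))
    + f x * b x (s_minus :: S))); last first.
  move=> j _; set v := s`_j.
  have Sj : S`_j = tangent_tractor v.
    by rewrite (nth_map 0).
  have jS : (j < size S)%N by rewrite sS.
  rewrite set_nth_tangent -/S Sj tractor_nabla_tangent lie_bracket_const.
  rewrite -[v]/(s`_j) -/v dchart_vector_field //.
  have F := alternating_set_nth (s := s_minus :: S) (m := j.+1) abx jS.
  have F0 := form_repeat_minus abx jS.
  have gV : a x [:: tangent_tractor v; s_minus] = - bil (g i x) (V i x) v.
    rewrite (interiorC _ s_minus) //= VE /= bil_sharp ?gunit // => k u u'.
    rewrite tangent_tractor_linear; exact: (proj1 aax [:: _] [::]).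
  set E := endo x (tangent_tractor v); set C := christoffel _ _ _ _ _.
  (* The s_plus slot agrees with that of E, the tangent slot with that of
     E + f v up to the bracket term, and s_minus absorbs the difference left. *)
  rewrite [(_, C, _)](_ : _ = (bil (Kg g i x) (V i x) v - E.1.1) *: s_minus
     + (1 *: E + (f x *: tangent_tractor v
     + tangent_tractor (- (E.1.2 + f x *: v - C))))); last first.
    congr (_, _, _) => /=.
    - rewrite -[RHS]/((bil (Kg g i x) (V i x) v - E.1.1) * 1
        + (1 * E.1.1 + (f x * 0 + 0))); ring.
    - by rewrite scaler0 add0r scale1r addrA opprB addrC subrK.
    - rewrite -[RHS]/((bil (Kg g i x) (V i x) v - E.1.1) * 0
        + (1 * a x [:: tangent_tractor v; s_minus] + (f x * 0 + 0))) gV; ring.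
  have /= -> := F (bil (Kg g i x) (V i x) v - E.1.1) s_minus; rewrite F0 mulr0 add0r.
  have /= -> := F 1 E; have /= -> := F (f x) (tangent_tractor v).
  rewrite mul1r !addrA addrK; congr (_ + _ * b x (_ :: _)).
  by rewrite -Sj set_nth_cat // -(drop_nth 0) // cat_take_drop.
rewrite big_split /= sumr_const card_ord -mulr_natl -natr1.
set Sg := \sum_(j < _) _; set F := b x _.
ring.
Qed.

End LieDerivative.

End ChartGeometry.

(** * Pseudo-Riemannian metrics *)

Section PseudoMetric.
Context {R : realType} {p q : nat}.
Local Notation n := (p + q)%N.
Local Notation T := 'rV[R]_n.
Local Notation TV := (@tractor R n).
Local Notation eps := (eps_mx R p q).

Lemma eps_mx_offdiag j k : j != k -> eps j k = 0.
Proof.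
rewrite /eps_mx; case: (split_ordP j) => j' ->; case: (split_ordP k) => k' -> jk.
- rewrite block_mxEul !mxE; case: eqP => [e|]; last by rewrite oppr0.
  by rewrite e eqxx in jk.
- by rewrite block_mxEur mxE.
- by rewrite block_mxEdl mxE.
- rewrite block_mxEdr !mxE; case: eqP => [e|//].
  by rewrite e eqxx in jk.
Qed.

Lemma eps_mx_diag j : eps j j = 1 \/ eps j j = -1.
Proof.
rewrite /eps_mx; case: (split_ordP j) => j' ->.
  by right; rewrite block_mxEul !mxE eqxx.
by left; rewrite block_mxEdr !mxE eqxx.
Qed.

Lemma eps_mx_unit : eps \in unitmx.
Proof.
suff /mulmx1_unit[] : eps *m eps = 1%:M by [].
rewrite /eps_mx mulmx_block !mul0mx !mulmx0 !addr0 !add0r mulmx1.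
by rewrite mulNmx mul1mx opprK -scalar_mx_block.
Qed.

Lemma orthonormal_frame_unit (E G : 'M[R]_n) : E *m G *m E^T = eps -> G \in unitmx.
Proof.
move=> EG; have := eps_mx_unit; rewrite -EG !unitmx_mul.
by case/andP=> /andP[].
Qed.

(** An orthonormal frame of the tangent space is completed by
    s_minus + s_plus / 2 and s_minus - s_plus / 2, of squares 1 and -1. *)
Lemma tractor_orthonormal_basis (E G : 'M[R]_n) : E *m G *m E^T = eps -> G^T = G ->
  exists e, pseudo_orthonormal (tmetric G : TV -> TV -> R) e.
Proof.
move=> EG Gsym.
pose l : seq TV := (1 : R^o, 0, 2^-1 : R^o) :: (1 : R^o, 0, - 2^-1 : R^o) ::
   [seq tangent_tractor (row j E) | j <- enum 'I_n].
have sl : size l == \dim {:TV}.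
  rewrite /l /= size_map size_enum_ord dimvf.
  by rewrite [dim _](_ : _ = (1 + 1 * n) + 1)%N // mul1n addn1 add1n.
have rowE j k : bil G (row j E) (row k E) = eps j k.
  by rewrite -EG /bil -row_mul tr_row !mxE; apply: eq_bigr => m _; rewrite !mxE.
have half : (2^-1 : R) + 2^-1 = 1 by field.
have lnth (m : nat) : (m < n)%N -> exists j : 'I_n, j = m :> nat /\
    nth 0 l m.+2 = tangent_tractor (row j E).
  move=> mn; exists (Ordinal mn); split=> //=.
  rewrite (nth_map (Ordinal mn)) ?size_enum_ord //; congr (tangent_tractor (row _ E)).
  by apply: val_inj; rewrite /= nth_enum_ord.
have bnd (i : 'I_(\dim {:TV})) : (i < n.+2)%N.
  by rewrite (leq_trans (ltn_ord i)) // -(eqP sl) /l /= size_map size_enum_ord.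
exists (Tuple sl); apply: orthonormal_tuple_basis.
- by move=> *; exact: tmetric_linear.
- by move=> *; exact: tmetric_sym.
- move=> i j; rewrite -val_eqE !(tnth_nth 0) /= -/l.
  move: (bnd i) (bnd j); case: (val i) => [|[|mi]]; case: (val j) => [|[|mj]] //;
    rewrite ?ltnS.
  + by move=> *; rewrite /tmetric /= bil0l; ring.
  + move=> _ /lnth[k [_ ->]] _; rewrite /tmetric /= bil0l; ring.
  + by move=> *; rewrite /tmetric /= bil0l; ring.
  + move=> _ /lnth[k [_ ->]] _; rewrite /tmetric /= bil0l; ring.
  + move=> /lnth[k [_ ->]] _ _; rewrite /tmetric /= bil0r; ring.
  + move=> /lnth[k [_ ->]] _ _; rewrite /tmetric /= bil0r; ring.
  + move=> /lnth[k [<- ->]] /lnth[k' [<- ->]]; rewrite !eqSS val_eqE => kk.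
    by rewrite /tmetric /= rowE eps_mx_offdiag //; ring.
- move=> i; rewrite (tnth_nth 0) /= -/l; move: (bnd i).
  case: (val i) => [|[|mi]]; rewrite ?ltnS.
  + by left; rewrite /tmetric /= bil0l !mul1r addr0.
  + by right; rewrite /tmetric /= bil0l !mul1r addr0 -opprD half.
  + move=> /lnth[k [_ ->]]; rewrite /tmetric /= rowE !mul0r !add0r.
    exact: eps_mx_diag.
Qed.

Context {M : topologicalType}.
Variable A : smooth_manifold R n M.
Implicit Types (g : metric_field A) (i : chart A).

Lemma pseudo_metric_sym g : pseudo_metric g ->
  forall i x, chart_dom i x -> (g i x)^T = g i x.
Proof. by case. Qed.

Lemma pseudo_metric_unit g : pseudo_metric g ->
  forall i x, chart_dom i x -> g i x \in unitmx.
Proof. by case=> _ gE _ _ i x /gE[E /orthonormal_frame_unit]. Qed.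

Lemma pseudo_metric_smooth g : pseudo_metric g ->
  forall i j k, smooth_in i (fun y => g i y j k : R^o).
Proof. by case=> _ _ gs _ i j k; exact: chart_smooth_mx. Qed.

Lemma pseudo_metric_basis g i x : pseudo_metric g -> chart_dom i x ->
  exists e, pseudo_orthonormal (tmetric (g i x) : TV -> TV -> R) e.
Proof.
move=> pg dx; have [gsym gE _ _] := pg; have [E EG] := gE i x dx.
exact: tractor_orthonormal_basis EG (gsym i x dx).
Qed.

Lemma tractor_chart_isometry g i j x (u v : TV) : pseudo_metric g ->
  chart_dom i x -> chart_dom j x ->
  tmetric (g j x) (tractor_chart i j x u) (tractor_chart i j x v) = tmetric (g i x) u v.
Proof. by case=> _ _ _ gij di dj; rewrite /tmetric /= -gij. Qed.

(** The weights of the two outer slots cancel each other, that of the tangent slot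
    cancels the weight of the metric, and the gradient terms of the tangent slot
    cancel those of the first slot. *)
Lemma tractor_conf_isometry g g' sigma i x (u v : TV) : pseudo_metric g ->
  rescaled g g' sigma -> chart_dom i x ->
  tmetric (g' i x) (tractor_conf g sigma i x u) (tractor_conf g sigma i x v)
  = tmetric (g i x) u v.
Proof.
move=> pg [ss gg'] dx; have gu := pseudo_metric_unit pg dx.
case: u v => [[a Y] b] [[a' Y'] b']; rewrite /tmetric /tractor_conf /= gg' // bilZm.
set xi := fun v => dchart i v sigma x.
have xil : dual_vector xi.
  by move=> k u v; rewrite /xi dchart_linear //; exact: SmoothIn (ss i).
rewrite !(bilZl, bilZr, bilDl, bilDr) (bil_sym (pseudo_metric_sym pg dx) Y (sharp _ _)).
rewrite !bil_sharp //.
have e2 : expR (2 * sigma x) = expR (sigma x) * expR (sigma x).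
  by rewrite -expRD -mulr2n mulr_natl.
have eN : expR (- sigma x) = (expR (sigma x))^-1 by rewrite expRN.
rewrite e2 eN; have e0 : expR (sigma x) != 0 by rewrite gt_eqF // expR_gt0.
rewrite -/(xi Y) -/(xi Y') -/(xi (sharp _ _)).
by move: (expR (sigma x)) e0 (xi Y) (xi Y') (xi (sharp _ _)) (bil _ _ _) => e e0 *; field.
Qed.

End PseudoMetric.

(** * The bracket of parallel tractor forms *)

Section ConformalClass.
Context {R : realType} {p q : nat} {M : topologicalType}.
Local Notation n := (p + q)%N.
Local Notation T := 'rV[R]_n.
Local Notation TV := (@tractor R n).
Variables (A : smooth_manifold R n M) (c : set (metric_field A)).
Hypothesis cc : conformal_class c.
Implicit Types (g : metric_field A) (i : chart A).

Lemma conformal_class_metric g : c g -> pseudo_metric g.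
Proof. by case: cc => g0 _ h /h[]. Qed.

Lemma Par_chart_parallel r w g i : Par c r w -> c g -> chart_parallel i g (w g i).
Proof.
move=> [[fw sw _ _] pw] cg; split=> [x dx|s|x dx X s].
- by case: (fw g i x cg dx).
- exact: SmoothIn (sw g i s cg).
- exact: pw.
Qed.

Variables (k : nat) (alpha beta : tractor_form_field A).
Hypothesis pa : Par c 2 alpha.
Hypothesis pb : Par c k.+1 beta.

Definition half_bracket : tractor_form_field A :=
  fun g i x s => 2^-1 * tractor_bracket beta alpha g i x s.

(** The tractor metric has an orthonormal basis at each point of the chart, so the
    Clifford bracket is a derivation there. *)
Lemma half_bracketE g i x s : c g -> chart_dom i x ->
  half_bracket g i x s =
    derivation (tractor_endo (g i x) (alpha g i x)) (beta g i x) s.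
Proof.
move=> cg dx; have pg := conformal_class_metric cg.
have [[fa _ _ _] _] := pa; have [[fb _ _ _] _] := pb.
rewrite /half_bracket /tractor_bracket.
have tl : forall z a u v, tmetric (g i x) (a *: u + v : TV) z =
    a * tmetric (g i x) u z + tmetric (g i x) v z.
  by move=> *; exact: tmetric_linear.
have ts : forall u v : TV, tmetric (g i x) u v = tmetric (g i x) v u.
  by move=> *; apply: tmetric_sym; exact: pseudo_metric_sym.
rewrite (@clifford_bracket _ _ _ tl ts _ _ (tractor_endo (g i x) (alpha g i x))).
- by rewrite /derivation; field.
- exact: pseudo_metric_basis.
- exact: fa.
- by case: (fb g i x cg dx).
- move=> t u; apply: tmetric_tractor_endo; first exact: pseudo_metric_unit.
  by case: (fa g i x cg dx).
Qed.

Lemma tmetric_endo g i x t u : c g -> chart_dom i x ->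
  tmetric (g i x) (tractor_endo (g i x) (alpha g i x) t) u = alpha g i x [:: t; u].
Proof.
move=> cg dx; have [[fa _ _ _] _] := pa.
apply: tmetric_tractor_endo; first exact: pseudo_metric_unit (conformal_class_metric cg) _ _ _.
by case: (fa g i x cg dx).
Qed.

(** Isometric identifications of tractors that match alpha match the skew
    endomorphisms, hence the derivations. *)
Lemma half_bracket_isometry g g' i j x tau s : c g -> c g' ->
  chart_dom i x -> chart_dom j x ->
  (forall u v, tmetric (g' j x) (tau u) (tau v) = tmetric (g i x) u v) ->
  (forall s, alpha g i x s = alpha g' j x (map tau s)) ->
  (forall s, beta g i x s = beta g' j x (map tau s)) ->
  half_bracket g i x s = half_bracket g' j x (map tau s).
Proof.
move=> cg cg' di dj iso ha hb; rewrite !half_bracketE //.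
apply: derivation_map => // t.
apply: (isometry_skew (B := tmetric (g i x)) (B' := tmetric (g' j x))
  (a := alpha g i x) (a' := alpha g' j x)).
- by move=> *; exact: tmetric_linear.
- by move=> *; apply: tmetric_sym; exact: pseudo_metric_sym (conformal_class_metric cg') _ _ _.
- exact: pseudo_metric_basis (conformal_class_metric cg) di.
- exact: iso.
- by move=> *; exact: tmetric_endo.
- by move=> *; exact: tmetric_endo.
- by move=> u v; rewrite ha.
Qed.

Lemma Par_half_bracket : Par c k.+1 half_bracket.
Proof.
have [[fa sa ta ra] _] := pa; have [[fb sb tb rb] _] := pb.
have wa g i (cg : c g) := Par_chart_parallel i pa cg.
have wb g i (cg : c g) := Par_chart_parallel i pb cg.
have gsym g (cg : c g) := pseudo_metric_sym (conformal_class_metric cg).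
have gunit g (cg : c g) := pseudo_metric_unit (conformal_class_metric cg).
have gsm g (cg : c g) := pseudo_metric_smooth (conformal_class_metric cg).
split; first split.
- move=> g i x cg dx; have pg := conformal_class_metric cg.
  have [ab b0] := fb g i x cg dx; split.
    apply: alternatingZ; apply: alternating_clifford_bracket => //.
    + by move=> *; exact: tmetric_linear.
    + by move=> *; apply: tmetric_sym; exact: gsym.
    + exact: pseudo_metric_basis.
    + exact: fa.
  move=> s ss; rewrite half_bracketE // /derivation big1 // => m _.
  by rewrite b0 // size_set_nth; rewrite (maxn_idPr _).
- move=> g i s cg.
  suff [] : smooth_in i (fun y => half_bracket g i y s) by [].
  apply: (@chart_smooth_eq _ _ _ _ _ (fun y =>
    derivation (tractor_endo (g i y) (alpha g i y)) (beta g i y) s)).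
    by move=> y dy; rewrite half_bracketE.
  have [ab sb' _] := wb g i cg.
  apply: chart_smooth_sum => m; apply: smooth_form_entry => //.
  by apply: (smooth_tractor_endo (gunit g cg i) (gsm g cg i)); exact: wa.
- move=> g i j x s cg di dj; apply: half_bracket_isometry => // [u v|s'|s'].
  + by apply: tractor_chart_isometry => //; exact: conformal_class_metric.
  + exact: ta.
  + exact: tb.
- move=> g g' sigma i x s cg cg' rs dx; apply: half_bracket_isometry => // [u v|s'|s'].
  + by apply: tractor_conf_isometry => //; exact: conformal_class_metric.
  + exact: ra.
  + exact: rb.
- move=> g i x cg dx X s.
  rewrite -[RHS](derivation_parallel (gsym g cg i) (gunit g cg i) (gsm g cg i) X s
     (wa g i cg) (wb g i cg) dx).
  rewrite /tractor_form_nabla; congr (_ - _).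
    by apply: dchart_eq => // y dy; rewrite half_bracketE.
  by apply: eq_bigr => m _; rewrite half_bracketE.
Qed.

End ConformalClass.

Section KillingFields.
Context {R : realType} {p q : nat} {M : topologicalType}.
Local Notation n := (p + q)%N.
Local Notation T := 'rV[R]_n.
Local Notation TV := (@tractor R n).
Variables (A : smooth_manifold R n M) (c : set (metric_field A)).
Hypothesis cc : conformal_class c.
Variable alpha : tractor_form_field A.
Hypothesis pa : Par c 2 alpha.
Variable g : metric_field A.
Hypothesis cg : c g.
Local Notation V := (sharp_field g (proj_plus g alpha)).
Local Notation f i x := (alpha g i x [:: s_plus; s_minus]).
Implicit Types (i : chart A).

Let pg := conformal_class_metric cc cg.
Let gsym i x (dx : chart_dom i x) : (g i x)^T = g i x := pseudo_metric_sym pg dx.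
Let gunit i x (dx : chart_dom i x) : g i x \in unitmx := pseudo_metric_unit pg dx.
Let gsmooth i j k : smooth_in i (fun y => g i y j k : R^o) :=
  pseudo_metric_smooth pg i j k.
Let pai i := Par_chart_parallel i pa cg.

(** Changes of chart fix s_plus and s_minus. *)
Lemma factor_chart_independent i (j : chart A) x :
  chart_dom i x -> chart_dom j x -> f i x = f j x.
Proof.
move=> di dj; have [[_ _ ta _] _] := pa; rewrite (ta g i j x _ cg di dj) /=.
have d0 : dtrans i j x 0 = 0 by rewrite /dtrans /dchart derive0.
by rewrite /tractor_chart /= d0.
Qed.

Lemma lie_metric_factor i x u v : chart_dom i x ->
  lie_metric V g i x u v = 2 * f i x * bil (g i x) u v.
Proof.
exact: (lie_metric_vector_field (@gsym i) (@gunit i) (gsmooth i) (pai i)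
  (V := V) (fun=> erefl)).
Qed.

Lemma conformal_factor_exists : exists lambda, conformal_factor g V lambda.
Proof.
(* f is read at each point in some chart around it. *)
pose ix x := sval (cid (dom_cover A x)).
have dix x : chart_dom (ix x) x by rewrite /ix; case: cid.
have fE i x : chart_dom i x -> f (ix x) x = f i x.
  by move=> dx; exact: factor_chart_independent.
exists (fun x => f (ix x) x); split=> [i|i x dx u v].
  suff [] : smooth_in i (fun x => f (ix x) x) by [].
  apply: (@chart_smooth_eq _ _ _ _ _ (fun x => f i x)); first by move=> y /fE.
  by have [_ sa _] := pai i; exact: sa.
by rewrite lie_metric_factor // (fE i x dx).
Qed.

(** In positive dimension a nondegenerate g takes a nonzero value, at which the
    two expressions for the Lie derivative of g can be compared. *)
Lemma conformal_factorE lambda i x : (0 < n)%N -> conformal_factor g V lambda ->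
  chart_dom i x -> lambda x = f i x.
Proof.
move=> n0 [_ lam] dx; apply/eqP/negPn/negP => ne.
pose u : T := const_mx 1.
suff /rowP /(_ (Ordinal n0)) : u = 0.
  by rewrite !mxE => /eqP; rewrite oner_eq0.
apply: (bil_nondegenerate (pseudo_metric_unit pg dx)) => v.
have := lam i x dx u v; rewrite lie_metric_factor // => /eqP.
rewrite -subr_eq0 -mulrBl mulf_eq0 -mulrBr mulf_eq0 pnatr_eq0 /= subr_eq0 eq_sym.
by rewrite (negbTE ne) => /eqP.
Qed.

(** Both sides vanish on lists of a length other than k; on lists of length k this
    is lie_form_plus. *)
Lemma lie_form_half_bracket k beta i x s : Par c k.+1 beta -> chart_dom i x ->
  lie_form V (proj_plus g beta) i x s - k.+1%:R * f i x * proj_plus g beta i x s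
  = 2^-1 * proj_plus g (tractor_bracket beta alpha) i x s.
Proof.
move=> pb dx.
transitivity (plus_part (derivation (tractor_endo (g i x) (alpha g i x)) (beta g i x)) s);
  last by rewrite /plus_part -(half_bracketE cc pa pb).
rewrite -(lie_form_plus (@gsym i) (@gunit i) (gsmooth i) (pai i)
  (V := V) (fun=> erefl)
  (Par_chart_parallel i pb cg) (w := proj_plus g beta) s (fun=> erefl) dx).
have [ss|ss] := eqVneq (size s) k; first by rewrite ss.
have -> : proj_plus g beta i x s = 0; last by rewrite !mulr0.
have [[fb _ _ _] _] := pb; apply: (fb g i x cg dx).2.
by rewrite /= size_map => -[] /eqP; rewrite (negbTE ss).
Qed.

End KillingFields.

Theorem proposition22 (R : realType) (p q k : nat) (M : topologicalType)
    (A : smooth_manifold R (p + q) M) (c : set (metric_field A))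
    (alpha beta : tractor_form_field A) (g : metric_field A) :
  (3 <= p + q)%N ->
  connected [set: M] ->
  conformal_class c ->
  oriented_spin c ->
  (k <= p + q)%N ->
  Par c 2 alpha ->
  Par c k.+1 beta ->
  c g ->
  let V := sharp_field g (proj_plus g alpha) in
  let beta_plus := proj_plus g beta in
  let bracket_plus := proj_plus g (tractor_bracket beta alpha) in
  (exists lambda, conformal_factor g V lambda) /\
  (forall lambda, conformal_factor g V lambda ->
     let rhs : form_field A := fun i x s =>
       lie_form V beta_plus i x s - k.+1%:R * lambda x * beta_plus i x s in
     eq_form_field (fun i x s => 2^-1 * bracket_plus i x s) rhs /\
     nc_killing c k g rhs).
Proof.
move=> n3 _ cc _ _ pa pb cg V beta_plus bracket_plus.
split=> [|lambda lam rhs]; first exact: (conformal_factor_exists cc pa cg).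
have n0 : (0 < p + q)%N by apply: leq_trans n3.
have E : eq_form_field (fun i x s => 2^-1 * bracket_plus i x s) rhs.
  move=> i x dx s; rewrite /rhs (conformal_factorE cc pa cg n0 lam dx).
  by rewrite (lie_form_half_bracket cc pa cg s pb dx).
split=> //; exists (half_bracket alpha beta); first exact: Par_half_bracket.
by move=> i x dx s; rewrite -E.
Qed.
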